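(* Let $\Gamma=(V,E,s,t)$ be a multiquiver with incidence matrix $\gamma$, let $\mathcal{A}(\Gamma)$ be the corresponding TGW algebra and $\varphi_\Gamma:\mathcal{A}(\Gamma)\to A_E(\Bbbk)$ the canonical representation by differential operators. Let $\bar\Gamma$ denote the underlying undirected graph of $\Gamma$. Then the following two statements are equivalent: (i) $\varphi_\Gamma$ is locally surjective, i.e. $\varphi_\Gamma(\mathcal{A}(\Gamma)_g)=A_E(\Bbbk)_{\gamma(g)}$ for all $g\in\mathbb{Z}V$; (ii) $\bar\Gamma$ is acyclic.
   Context: $\Bbbk$ is a field of characteristic zero; rings are associative and unital; $\mathbb{Z}X$ denotes the free abelian group on a set $X$. TGW algebras. A TGW datum $(R,\sigma,t)$ with index set $I$: a $\Bbbk$-algebra $R$, commuting $\Bbbk$-algebra automorphisms $\sigma=(\sigma_i)_{i\in I}$ of $R$, nonzero central elements $t=(t_i)_{i\in I}$ of $R$. Given $\mu=(\mu_{ij})_{i\ne j}$ with $\mu_{ij}\in\Bbbk\setminus\{0\}$, $\mathcal{C}_\mu(R,\sigma,t)$ is the free $R$-ring on symbols $X_i,Y_i$ ($i\in I$) modulo the relations $X_ir=\sigma_i(r)X_i$, $Y_ir=\sigma_i^{-1}(r)Y_i$, $Y_iX_i=t_i$, $X_iY_i=\sigma_i(t_i)$ ($r\in R$, $i\in I$), $X_iY_j=\mu_{ij}Y_jX_i$ ($i\neq j$). It is $\mathbb{Z}I$-graded by $\deg X_i=i$, $\deg Y_i=-i$, $\deg r=0$. The TGW algebra $\mathcal{A}_\mu(R,\sigma,t)$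 is the quotient of $\mathcal{C}_\mu(R,\sigma,t)$ by the sum of all graded ideals having zero intersection with the degree-zero component; it is $\mathbb{Z}I$-graded. Multiquivers. A multiquiver $\Gamma=(V,E,s,t)$ consists of sets $V$ (vertices), $E$ (edges) and functions $s,t:E\to (V\times\mathbb{Z}_{>0})\cup\{\emptyset\}$ such that (no loops) if $s(e)=(u,m)$ and $t(e)=(v,n)$ then $u\ne v$; and (local finiteness) for each $v\in V$ only finitely many $e$ have $s(e)\in\{v\}\times\mathbb{Z}_{>0}$ or $t(e)\in\{v\}\times\mathbb{Z}_{>0}$. If $s(e)=(v,n)$ (resp. $t(e)=(v,n)$), $v$ is the source (resp. target) of $e$. Edges may lack a source or a target (value $\emptyset$). The incidence matrix is $\gamma:\mathbb{Z}V\to\mathbb{Z}E$, $\gamma(v)=\sum_{e\in E}\gamma_{ev}e$, where $\gamma_{ev}=n$ if $t(e)=(v,n)$, $\gamma_{ev}=-n$ if $s(e)=(v,n)$, and $\gamma_{ev}=0$ otherwise. $\mathcal{A}(\Gamma)$ is the TGW algebra $\mathcal{A}_\mu(R_E,\sigma^\Gamma,t^\Gamma)$ with index set $V$, where all $\mu_{ij}=1$, $R_E=\Bbbk[u_e\mid e\in E]$ (polynomial algebra), $\sigma_v(u_e)=u_e-\gamma_{ev}$, $t_v=\prod_{e\in E}u_{ev}$ with $u_{ev}=u_e(u_e+1)\cdots(u_e+\gamma_{ev}-1)$ if $\gamma_{ev}>0$, $u_{ev}=1$ if $\gamma_{ev}=0$, $u_{ev}=(u_e-1)(u_e-2)\cdots(u_e-|\gamma_{ev}|)$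 if $\gamma_{ev}<0$. $A_E(\Bbbk)$ is the Weyl algebra: generators $x_e,y_e$ ($e\in E$), relations $[x_e,x_{e'}]=[y_e,y_{e'}]=0$, $[y_e,x_{e'}]=\delta_{ee'}$; it is $\mathbb{Z}E$-graded by $\deg x_e=e$, $\deg y_e=-e$. For $k=\sum k_ee\in\mathbb{Z}E$ put $z^k=\prod_e z_e^{(k_e)}$ with $z_e^{(p)}=x_e^p$ if $p\ge0$ and $z_e^{(p)}=y_e^{-p}$ if $p<0$. The canonical representation $\varphi_\Gamma:\mathcal{A}(\Gamma)\to A_E(\Bbbk)$ is the algebra homomorphism with $\varphi_\Gamma(X_v)=z^{\gamma(v)}$, $\varphi_\Gamma(Y_v)=z^{-\gamma(v)}$, $\varphi_\Gamma(u_e)=y_ex_e$. The underlying undirected graph $\bar\Gamma$ is obtained by forgetting the direction of each edge (parallel edges are kept). $\bar\Gamma$ acyclic means that it contains no cycle, i.e. there are no $n\ge 2$, distinct vertices $v_1,\dots,v_n$ and distinct edges $e_1,\dots,e_n$ such that $e_i$ joins $v_i$ and $v_{i+1}$ (in either direction) for all $i$, where $v_{n+1}=v_1$. In particular two distinct edges between the same two vertices form a cycle. *)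

(* Defs.v *)
From HB Require Import structures.
From mathcomp Require Import all_boot all_order all_algebra.
From mathcomp Require Import finmap boolp classical_sets cardinality fsbigop.
From mathcomp.multinomials Require Import monalg.

Set Implicit Arguments.
Unset Strict Implicit.
Unset Printing Implicit Defensive.

Import GRing.Theory.

Local Open Scope classical_set_scope.
Local Open Scope quotient_scope.
Local Open Scope ring_scope.

Section Ideals.
Variable A : pzRingType.

Definition is_ideal (J : set A) : Prop :=
  [/\ J 0,
      forall x y, J x -> J y -> J (x - y),
      forall a x, J x -> J (a * x) &
      forall a x, J x -> J (x * a)].

Definition ideal_gen (S : set A) : set A := smallest is_ideal S.

Lemma ideal_gen_ideal S : is_ideal (ideal_gen S).
Proof.
split=> [J [[]]//|x y Jx Jy J JS|a x Jx J JS|a x Jx J JS];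
  case: (JS) => -[J0 JB Jl Jr] _.
- by apply: (JB _ _); [exact: Jx | exact: Jy].
- by apply: (Jl _ _); exact: Jx.
- by apply: (Jr _ _); exact: Jx.
Qed.

Definition ideal_rel (S : set A) : rel A :=
  fun x y => `[< ideal_gen S (x - y) >].

Lemma ideal_rel_equiv S : equiv_class_of (ideal_rel S).
Proof.
have [J0 JB Jl Jr] := ideal_gen_ideal S; split.
- by move=> x; apply/asboolP; rewrite subrr.
- have sym x y : ideal_rel S x y -> ideal_rel S y x.
    by move/asboolP=> h; apply/asboolP; rewrite -opprB -[- _]add0r; exact: JB.
  by move=> x y; apply/idP/idP; exact: sym.
- move=> y x z /asboolP hxy /asboolP hyz; apply/asboolP.
  have -> : x - z = (x - y) - (0 - (y - z)) by rewrite sub0r opprK addrA subrK.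
  by apply: (JB _ _) => //; exact: JB.
Qed.

Canonical ideal_rel_eqv S := EquivRelPack (ideal_rel_equiv S).

(* The quotient of [A] by the two-sided ideal generated by [S]. *)
Definition quot (S : set A) := {eq_quot (ideal_rel_eqv S)}.

End Ideals.

Section QuotRing.
Variables (A : pzRingType) (S : set A).
Local Notation Q := (quot S).

HB.instance Definition _ := Choice.on Q.
HB.instance Definition _ := EqQuotient.on Q.

Lemma quot_eqP (x y : A) : reflect (ideal_gen S (x - y)) (x == y %[mod Q]).
Proof.
have -> : (x == y %[mod Q]) = ideal_rel S x y by rewrite piE.
exact: asboolP.
Qed.

Definition quot_zero : Q := lift_cst Q 0.
Definition quot_one : Q := lift_cst Q 1.
Definition quot_opp := lift_op1 Q -%R.
Definition quot_add := lift_op2 Q +%R.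
Definition quot_mul := lift_op2 Q *%R.

Let Jid := ideal_gen_ideal S.

Lemma quot_repr (x : A) : ideal_gen S (x - repr (\pi_Q x)).
Proof. by apply/quot_eqP; rewrite reprK eqxx. Qed.

Lemma pi_quot_zero : \pi_Q 0 = quot_zero.
Proof. by rewrite /quot_zero -lock. Qed.
Canonical pi_quot_zero_morph := PiMorph pi_quot_zero.

Lemma pi_quot_one : \pi_Q 1 = quot_one.
Proof. by rewrite /quot_one -lock. Qed.
Canonical pi_quot_one_morph := PiMorph pi_quot_one.

Lemma pi_quot_opp : {morph \pi_Q : x / - x >-> quot_opp x}.
Proof.
move=> x; rewrite /quot_opp -lock; apply/eqP/quot_eqP; have [J0 JB _ _] := Jid.
by rewrite -opprD -[- _]add0r; apply: (JB _ _) => //; exact: quot_repr.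
Qed.
Canonical pi_quot_opp_morph := PiMorph1 pi_quot_opp.

Lemma pi_quot_add : {morph \pi_Q : x y / x + y >-> quot_add x y}.
Proof.
move=> x y; rewrite /quot_add -lock; apply/eqP/quot_eqP; have [J0 JB _ _] := Jid.
rewrite opprD addrACA -[y - _]opprK; apply: (JB _ _); first exact: quot_repr.
by rewrite -[- _]add0r; apply: (JB _ _) => //; exact: quot_repr.
Qed.
Canonical pi_quot_add_morph := PiMorph2 pi_quot_add.

Lemma pi_quot_mul : {morph \pi_Q : x y / x * y >-> quot_mul x y}.
Proof.
move=> x y; rewrite /quot_mul -lock; apply/eqP/quot_eqP; have [J0 JB Jl Jr] := Jid.
set x' := repr _; set y' := repr _.
have -> : x * y - x' * y' = (x - x') * y - (0 - x' * (y - y')).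
  by rewrite sub0r opprK mulrBl mulrBr addrA subrK.
apply: (JB _ _); first by apply: (Jr _ _); exact: quot_repr.
by apply: (JB _ _) => //; apply: (Jl _ _); exact: quot_repr.
Qed.
Canonical pi_quot_mul_morph := PiMorph2 pi_quot_mul.

Lemma quot_addA : associative quot_add.
Proof. by move=> x y z; rewrite -[x]reprK -[y]reprK -[z]reprK !piE addrA. Qed.
Lemma quot_addC : commutative quot_add.
Proof. by move=> x y; rewrite -[x]reprK -[y]reprK !piE addrC. Qed.
Lemma quot_add0 : left_id quot_zero quot_add.
Proof. by move=> x; rewrite -[x]reprK !piE add0r. Qed.
Lemma quot_addN : left_inverse quot_zero quot_opp quot_add.
Proof. by move=> x; rewrite -[x]reprK !piE addNr. Qed.

HB.instance Definition _ := GRing.isZmodule.Build Q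
  quot_addA quot_addC quot_add0 quot_addN.

Lemma quot_mulA : associative quot_mul.
Proof. by move=> x y z; rewrite -[x]reprK -[y]reprK -[z]reprK !piE mulrA. Qed.
Lemma quot_mul1 : left_id quot_one quot_mul.
Proof. by move=> x; rewrite -[x]reprK !piE mul1r. Qed.
Lemma quot_mulr1 : right_id quot_one quot_mul.
Proof. by move=> x; rewrite -[x]reprK !piE mulr1. Qed.
Lemma quot_mulDl : left_distributive quot_mul (@GRing.add Q).
Proof.
by move=> x y z; rewrite -[x]reprK -[y]reprK -[z]reprK /GRing.add /= !piE mulrDl.
Qed.
Lemma quot_mulDr : right_distributive quot_mul (@GRing.add Q).
Proof.
by move=> x y z; rewrite -[x]reprK -[y]reprK -[z]reprK /GRing.add /= !piE mulrDr.
Qed.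

HB.instance Definition _ := GRing.Zmodule_isPzRing.Build Q
  quot_mulA quot_mul1 quot_mulr1 quot_mulDl quot_mulDr.

End QuotRing.

Section Grading.
Variables (K : nzRingType) (G : choiceType) (D : zmodType) (deg : G -> D).

Definition fgen (a : G) : {malg K[{fmonom G}]} := << fmu a >>.

Definition word_deg (w : {fmonom G}) : D := \sum_(a <- w) deg a.

Definition free_comp (d : D) : set {malg K[{fmonom G}]} :=
  [set p | forall w, w \in msupp p -> word_deg w = d].

End Grading.

Record tgw_datum (k : fieldType) (R : algType k) (I : choiceType) := TGWDatum {
  tgw_sigma : I -> {lrmorphism R -> R};
  tgw_sigmaV : I -> R -> R;
  tgw_sigmaK : forall i, cancel (tgw_sigma i) (tgw_sigmaV i);
  tgw_sigmaVK : forall i, cancel (tgw_sigmaV i) (tgw_sigma i);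
  tgw_sigmaC : forall i j r,
    tgw_sigma i (tgw_sigma j r) = tgw_sigma j (tgw_sigma i r);
  tgw_t : I -> R;
  tgw_t_neq0 : forall i, tgw_t i != 0;
  tgw_t_central : forall i r, tgw_t i * r = r * tgw_t i;
  (* the diagonal entries mu i i are never used *)
  tgw_mu : I -> I -> k;
  tgw_mu_neq0 : forall i j, i != j -> tgw_mu i j != 0
}.

Section TGW.
Variables (k : fieldType) (R : algType k) (I : choiceType).
Variable T : tgw_datum R I.

Definition tgw_letter : choiceType := (R + (I + I))%type.

Definition tgw_free := {malg int[{fmonom tgw_letter}]}.

Definition tgw_freeR (r : R) : tgw_free := fgen int (inl r : tgw_letter).
Definition tgw_freeX (i : I) : tgw_free := fgen int (inr (inl i) : tgw_letter).
Definition tgw_freeY (i : I) : tgw_free := fgen int (inr (inr i) : tgw_letter).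

(* The free ring on R + I + I modulo the first three families is the free
   R-ring on the symbols X_i, Y_i. *)
Inductive tgw_rel : set tgw_free :=
| tgw_rel_one : tgw_rel (tgw_freeR 1 - 1)
| tgw_rel_add r s : tgw_rel (tgw_freeR (r + s) - (tgw_freeR r + tgw_freeR s))
| tgw_rel_mul r s : tgw_rel (tgw_freeR (r * s) - tgw_freeR r * tgw_freeR s)
| tgw_rel_X i r : tgw_rel (tgw_freeX i * tgw_freeR r - tgw_freeR (tgw_sigma T i r) * tgw_freeX i)
| tgw_rel_Y i r : tgw_rel (tgw_freeY i * tgw_freeR r - tgw_freeR (tgw_sigmaV T i r) * tgw_freeY i)
| tgw_rel_YX i : tgw_rel (tgw_freeY i * tgw_freeX i - tgw_freeR (tgw_t T i))
| tgw_rel_XY i : tgw_rel (tgw_freeX i * tgw_freeY i - tgw_freeR (tgw_sigma T i (tgw_t T i)))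
| tgw_rel_XYmu i j : i != j ->
    tgw_rel (tgw_freeX i * tgw_freeY j - tgw_freeR (tgw_mu T i j)%:A * tgw_freeY j * tgw_freeX i).

Definition tgwC : Type := quot tgw_rel.
HB.instance Definition _ := GRing.PzRing.on tgwC.

Definition tgw_deg (a : tgw_letter) : {malg int[I]} :=
  match a with
  | inl _ => 0
  | inr (inl i) => << i >>
  | inr (inr i) => - << i >>
  end.

Definition tgwC_comp (g : {malg int[I]}) : set tgwC :=
  \pi_(quot tgw_rel) @` free_comp tgw_deg g.

Definition is_graded (J : set tgwC) : Prop :=
  forall x, J x -> exists2 s : seq tgwC,
    (forall y, y \in s -> J y /\ exists g, tgwC_comp g y) &
    x = \sum_(y <- s) y.

(* The sum of the ideals in a family is the ideal generated by their union. *)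
Definition tgw_rad : set tgwC :=
  [set x | exists J : set tgwC, [/\ is_ideal J, is_graded J,
                                    J `&` tgwC_comp 0 = [set 0] & J x]].

Definition tgwA : Type := quot tgw_rad.
HB.instance Definition _ := GRing.PzRing.on tgwA.

Definition tgwA_pi (p : tgw_free) : tgwA :=
  \pi_(quot tgw_rad) (\pi_(quot tgw_rel) p : tgwC).

Definition tgwA_comp (g : {malg int[I]}) : set tgwA :=
  \pi_(quot tgw_rad) @` tgwC_comp g.

Definition tgwR (r : R) : tgwA := tgwA_pi (tgw_freeR r).
Definition tgwX (i : I) : tgwA := tgwA_pi (tgw_freeX i).
Definition tgwY (i : I) : tgwA := tgwA_pi (tgw_freeY i).

End TGW.

Arguments tgwC_comp {k R I} T g.
Arguments tgwA_comp {k R I} T g.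

Section Weyl.
Variables (k : fieldType) (E : choiceType).

Definition weyl_letter : choiceType := (E + E)%type.

Definition weyl_free := {malg k[{fmonom weyl_letter}]}.

Definition weyl_freex (e : E) : weyl_free := fgen k (inl e : weyl_letter).
Definition weyl_freey (e : E) : weyl_free := fgen k (inr e : weyl_letter).

Inductive weyl_rel : set weyl_free :=
| weyl_rel_xx e f : weyl_rel (weyl_freex e * weyl_freex f - weyl_freex f * weyl_freex e)
| weyl_rel_yy e f : weyl_rel (weyl_freey e * weyl_freey f - weyl_freey f * weyl_freey e)
| weyl_rel_yx e f : weyl_rel (weyl_freey e * weyl_freex f - weyl_freex f * weyl_freey e - (e == f)%:R).

Definition weyl : Type := quot weyl_rel.
HB.instance Definition _ := GRing.PzRing.on weyl.

Definition weyl_pi (p : weyl_free) : weyl := \pi_(quot weyl_rel) p.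
Definition weylC (c : k) : weyl := weyl_pi c%:MP.
Definition weylx (e : E) : weyl := weyl_pi (weyl_freex e).
Definition weyly (e : E) : weyl := weyl_pi (weyl_freey e).

Definition weyl_deg (a : weyl_letter) : {malg int[E]} :=
  match a with inl e => << e >> | inr e => - << e >> end.

Definition weyl_comp (h : {malg int[E]}) : set weyl :=
  weyl_pi @` free_comp weyl_deg h.

Definition weylz (e : E) (p : int) : weyl :=
  if 0 <= p then weylx e ^+ `|p|%N else weyly e ^+ `|p|%N.

(* The factors commute pairwise, so the enumeration order is irrelevant. *)
Definition weyl_mon (h : {malg int[E]}) : weyl :=
  \prod_(e <- msupp h) weylz e h@_e.

End Weyl.

Section PolySubst.
Variables (k : fieldType) (E : choiceType) (S : comAlgType k) (f : E -> S).

Definition cm_eval (m : {cmonom E}) : S := \prod_(e <- finsupp m) f e ^+ m e.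

Lemma cm_evalEw (d : {fset E}) (m : {cmonom E}) :
  (finsupp m `<=` d)%fset -> cm_eval m = \prod_(e <- d) f e ^+ m e.
Proof.
move=> le; rewrite /cm_eval (big_fset_incl _ le) // => e _.
by rewrite memNfinsupp => /eqP ->.
Qed.

Lemma cm_eval_mmorphism : mmorphism cm_eval.
Proof.
split=> [m n|]; last by rewrite /cm_eval mdom1 big_seq_fset0.
rewrite (@cm_evalEw _ m (fsubsetUl _ (finsupp n))).
rewrite (@cm_evalEw _ n (fsubsetUr (finsupp m) _)).
rewrite -big_split /= /cm_eval mdomD; apply: eq_bigr => e _.
by rewrite cmM exprD.
Qed.

HB.instance Definition _ :=
  isMultiplicative.Build {cmonom E} S cm_eval cm_eval_mmorphism.

(* The k-algebra morphism from k[u_e | e in E] to S mapping u_e to f e. *)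
Definition poly_subst : {malg k[{cmonom E}]} -> S := mmap (in_alg S) cm_eval.

HB.instance Definition _ := GRing.RMorphism.on poly_subst.

Lemma poly_subst_scalable : scalable poly_subst.
Proof. by move=> c p; rewrite /poly_subst mmapZ /= mulr_algl. Qed.

HB.instance Definition _ :=
  GRing.isScalable.Build k {malg k[{cmonom E}]} S *:%R poly_subst
    poly_subst_scalable.

End PolySubst.

Definition polyu (k : fieldType) (E : choiceType) (e : E) :
  {malg k[{cmonom E}]} := << ucm e >>.

Lemma malgUZ (K : choiceType) (A : nzRingType) (c : A) (m : K) :
  << c *g m >> = c *: << m >> :> {malg A[K]}.
Proof. by apply/malgP => n; rewrite mcoeffZ !mcoeffU mulrnAr mulr1. Qed.

Section PolySubstTheory.
Variables (k : fieldType) (E : choiceType).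
Local Notation RE := {malg k[{cmonom E}]}.

Lemma poly_substU (S : comAlgType k) (f : E -> S) e :
  poly_subst f (polyu k e) = f e.
Proof.
by rewrite /poly_subst mmapU /= scale1r mul1r /cm_eval mdomU big_seq_fset1 cmUU.
Qed.

Lemma malgUM (m n : {cmonom E}) : << mmul m n >> = << m >> * << n >> :> RE.
Proof. by rewrite malgM_def fgmulUU mulr1. Qed.

Lemma cm_eval_ucm (S : comAlgType k) (U : {cmonom E} -> S) m :
  mmorphism U ->
  cm_eval (fun e => U (ucm e)) m = U m.
Proof.
case=> UM U1.
have UX (n : {cmonom E}) j : U n ^+ j = U (iterop j mmul n mone).
  elim: j => [|j IHj]; first by rewrite expr0 U1.
  case: j IHj => [|j] IHj; first by rewrite expr1.
  by rewrite exprS IHj -UM.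
have -> : cm_eval (fun e => U (ucm e)) m =
    U (\big[mmul/mone]_(e <- finsupp m) iterop (m e) mmul (ucm e) mone).
  rewrite (big_morph U UM U1).
  by apply: eq_bigr => e _; exact: UX.
congr (U _); apply/eqP/cmP => e.
have iterE (n : {cmonom E}) j : iterop j mmul n mone e = (j * n e)%N.
  elim: j => [|j IHj]; first by rewrite cm1.
  by case: j IHj => [|j] IHj; rewrite ?mul1n //= cmM mulSn -IHj.
rewrite (big_morph (fun m : {cmonom E} => m e) (id1 := 0%N) (op1 := addn)).
- case: (finsuppP m e) => [Ne|He].
    rewrite big_seq big1 // => f fm; rewrite iterE cmU.
    by case: eqP fm Ne => [-> ->//|]; rewrite muln0.
  rewrite (big_fsetD1 e) //= iterE cmUU muln1 big_seq big1 ?addn0 // => f.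
  by rewrite in_fsetD1 => /andP[/negbTE fe _]; rewrite iterE cmU fe muln0.
- by move=> *; rewrite cmM.
- by rewrite cm1.
Qed.

Lemma malgU_mmorphism : mmorphism (fun m : {cmonom E} => << m >> : RE).
Proof. by split=> [m n|]; rewrite ?malgUM. Qed.

Lemma cm_eval_polyu m : cm_eval (@polyu k E) m = << m >>.
Proof. exact: (cm_eval_ucm m malgU_mmorphism). Qed.

Lemma poly_subst_uniq (S : comAlgType k) (h : {lrmorphism RE -> S}) p :
  h p = poly_subst (fun e => h (polyu k e)) p.
Proof.
rewrite [in LHS](monalgE p) raddf_sum; apply: eq_bigr => m _ /=.
rewrite malgUZ linearZ /= mulr_algl -cm_eval_polyu; congr (_ *: _).
rewrite /cm_eval rmorph_prod; apply: eq_bigr => e _.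
by rewrite rmorphXn.
Qed.

Lemma poly_subst_ext (S : comAlgType k) (h1 h2 : {lrmorphism RE -> S}) :
  (forall e, h1 (polyu k e) = h2 (polyu k e)) -> h1 =1 h2.
Proof.
move=> eqh p; rewrite (poly_subst_uniq h1) (poly_subst_uniq h2); congr (poly_subst _ p).
by apply: funext => e; exact: eqh.
Qed.

Lemma poly_subst_eq_id (h : {lrmorphism RE -> RE}) :
  (forall e, h (polyu k e) = polyu k e) -> h =1 id.
Proof. exact: (poly_subst_ext (h2 := idfun)). Qed.

End PolySubstTheory.

Definition posnat := {n : nat | (0 < n)%N}.

Record multiquiver (V E : choiceType) := Multiquiver {
  qsrc : E -> option (V * posnat);
  qtgt : E -> option (V * posnat);
  q_noloop : forall e u m v n,
    qsrc e = Some (u, m) -> qtgt e = Some (v, n) -> u <> v;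
  q_locfin : forall v, finite_set
    [set e | (exists n, qsrc e = Some (v, n)) \/ (exists n, qtgt e = Some (v, n))]
}.

Section Incidence.
Variables (V E : choiceType) (Γ : multiquiver V E).

Definition mult_at (o : option (V * posnat)) (v : V) : option nat :=
  if o is Some (w, n) then if w == v then Some (val n) else None else None.

Definition incid (e : E) (v : V) : int :=
  if mult_at (qtgt Γ e) v is Some n then n%:Z
  else if mult_at (qsrc Γ e) v is Some n then - n%:Z
  else 0.

Definition incid_vertex (v : V) : {malg int[E]} :=
  \sum_(e \in [set: E]) << incid e v *g e >>.

Definition incid_map (g : {malg int[V]}) : {malg int[E]} :=
  \sum_(v <- msupp g) incid_vertex v *~ g@_v.

Definition qjoins (e : E) (v w : V) : Prop :=
  exists m n, (qsrc Γ e = Some (v, m) /\ qtgt Γ e = Some (w, n)) \/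
              (qsrc Γ e = Some (w, m) /\ qtgt Γ e = Some (v, n)).

(* [ordS] is the cyclic successor on 'I_n. *)
Definition qacyclic : Prop :=
  ~ exists (n : nat) (v : 'I_n -> V) (e : 'I_n -> E),
      [/\ (2 <= n)%N, injective v, injective e &
          forall i, qjoins (e i) (v i) (v (ordS i))].

End Incidence.

Section QuiverDatum.
Variables (k : fieldType) (V E : choiceType) (Γ : multiquiver V E).
Local Notation RE := {malg k[{cmonom E}]}.

Definition quiver_sigma (v : V) : {lrmorphism RE -> RE} :=
  poly_subst (fun e => polyu k e - (incid Γ e v)%:~R).

Definition quiver_sigmaV (v : V) : {lrmorphism RE -> RE} :=
  poly_subst (fun e => polyu k e + (incid Γ e v)%:~R).

Definition quiver_tfactor (e : E) (v : V) : RE :=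
  if 0 <= incid Γ e v
  then \prod_(0 <= j < `|incid Γ e v|%N) (polyu k e + j%:R)
  else \prod_(1 <= j < `|incid Γ e v|%N.+1) (polyu k e - j%:R).

Definition quiver_t (v : V) : RE :=
  \big[*%R/1]_(e \in [set: E]) quiver_tfactor e v.

Lemma quiver_sigmaU v e :
  quiver_sigma v (polyu k e) = polyu k e - (incid Γ e v)%:~R.
Proof. exact: poly_substU. Qed.

Lemma quiver_sigmaVU v e :
  quiver_sigmaV v (polyu k e) = polyu k e + (incid Γ e v)%:~R.
Proof. exact: poly_substU. Qed.

Lemma quiver_sigmaK v : cancel (quiver_sigma v) (quiver_sigmaV v).
Proof.
pose h : {lrmorphism RE -> RE} := quiver_sigmaV v \o quiver_sigma v.
apply: (poly_subst_eq_id (h := h)) => e.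
rewrite -[LHS]/(quiver_sigmaV v (quiver_sigma v (polyu k e))).
by rewrite quiver_sigmaU rmorphB rmorph_int [X in X - _]quiver_sigmaVU addrK.
Qed.

Lemma quiver_sigmaVK v : cancel (quiver_sigmaV v) (quiver_sigma v).
Proof.
pose h : {lrmorphism RE -> RE} := quiver_sigma v \o quiver_sigmaV v.
apply: (poly_subst_eq_id (h := h)) => e.
rewrite -[LHS]/(quiver_sigma v (quiver_sigmaV v (polyu k e))).
by rewrite quiver_sigmaVU rmorphD rmorph_int [X in X + _]quiver_sigmaU subrK.
Qed.

Lemma quiver_sigmaC v w p :
  quiver_sigma v (quiver_sigma w p) = quiver_sigma w (quiver_sigma v p).
Proof.
pose h1 : {lrmorphism RE -> RE} := quiver_sigma v \o quiver_sigma w.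
pose h2 : {lrmorphism RE -> RE} := quiver_sigma w \o quiver_sigma v.
suff H : h1 =1 h2 by exact: (H p).
apply: poly_subst_ext => e.
have E2 v' w' : quiver_sigma v' (quiver_sigma w' (polyu k e)) =
    polyu k e - (incid Γ e v')%:~R - (incid Γ e w')%:~R.
  by rewrite quiver_sigmaU rmorphB rmorph_int [X in X - _]quiver_sigmaU.
rewrite [LHS]E2 [RHS]E2.
exact: addrAC.
Qed.

Lemma quiver_t_central v p : quiver_t v * p = p * quiver_t v.
Proof. exact: mulrC. Qed.

Hypothesis char0 : [pchar k] =i pred0.

Lemma quiver_t_neq0 v : quiver_t v != 0.
Proof.
have natk n : (n.+1%:R : k) != 0.
  by move/pcharf0P: char0 => ->.
pose f e : k^o := (`|incid Γ e v|%N).+1%:R.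
suff : (poly_subst f (quiver_t v) : k) != 0.
  by apply: contra => /eqP ->; rewrite rmorph0.
have prod_neq0 (T : eqType) (r : seq T) (F : T -> k) :
    {in r, forall x, F x != 0} -> \prod_(x <- r) F x != 0.
  by move=> F0; rewrite prodf_seq_neq0; apply/allP => x /F0; rewrite implyTb.
rewrite /quiver_t rmorph_prod; apply: (prod_neq0 _ _) => e _ /=.
rewrite /quiver_tfactor; case: ifP => _; rewrite rmorph_prod;
  apply: (prod_neq0 _ _) => j; rewrite mem_index_iota => /andP[_ hj] /=.
  rewrite rmorphD rmorph_nat [X in X + _]poly_substU.
  by rewrite -[X in X != 0](natrD k) addSn natk.
rewrite rmorphB rmorph_nat [X in X - _]poly_substU.
by rewrite -[X in X != 0](natrB k (ltnW hj)) subSn // natk.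
Qed.

Definition quiver_datum : tgw_datum RE V :=
  @TGWDatum k RE V quiver_sigma quiver_sigmaV quiver_sigmaK quiver_sigmaVK
    quiver_sigmaC quiver_t quiver_t_neq0 quiver_t_central
    (fun _ _ => 1) (fun _ _ _ => oner_neq0 k).

Definition quiver_tgw : Type := tgwA quiver_datum.
HB.instance Definition _ := GRing.PzRing.on quiver_tgw.

Definition quiver_comp (g : {malg int[V]}) : set quiver_tgw :=
  tgwA_comp quiver_datum g.

(* The first condition is k-linearity.  The elements tgwR r, tgwX v, tgwY v
   generate quiver_tgw, so that at most one morphism satisfies all four. *)
Definition is_canonical_rep (phi : {rmorphism quiver_tgw -> weyl k E}) : Prop :=
  [/\ forall c : k, phi (tgwR quiver_datum c%:A) = weylC E c,
      forall v, phi (tgwX quiver_datum v) = weyl_mon k (incid_vertex Γ v),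
      forall v, phi (tgwY quiver_datum v) = weyl_mon k (- incid_vertex Γ v) &
      forall e, phi (tgwR quiver_datum (polyu k e)) = weyly k e * weylx k e].

Definition locally_surjective (phi : quiver_tgw -> weyl k E) : Prop :=
  forall g : {malg int[V]},
    phi @` quiver_comp g = weyl_comp (incid_map Γ g).

End QuiverDatum.

(* Main.v *)
Require Import Defs.
From HB Require Import structures.
From mathcomp Require Import all_boot all_order all_algebra.
From mathcomp Require Import finmap boolp classical_sets cardinality fsbigop.
From mathcomp.multinomials Require Import monalg.
From mathcomp Require Import zify ring.

Set Implicit Arguments.
Unset Strict Implicit.
Unset Printing Implicit Defensive.

Import GRing.Theory Num.Theory Order.TTheory.

Local Open Scope classical_set_scope.
Local Open Scope quotient_scope.
Local Open Scope ring_scope.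

(** Write [M h] for the monomial z^h and [u_e] for [y_e * x_e].  The component of
    degree [h] of the Weyl algebra is k[u] * M h, so local surjectivity at [g]
    says that [M (γ g)] lies in the image of the component of degree [g].

    If Γ is acyclic, remove from the support of [g] a vertex [v] joined to the
    rest of the support by at most one edge [e].  The monomials of [v] and of
    the rest multiply without cancellation except at [e]; there the products in
    the two orders are p(u_e) and q(u_e) times the expected power with p and q
    coprime in characteristic zero, and Bezout gives [M (γ g)].

    If Γ contains a cycle, let [g] be the sum of its vertices.  In a suitable
    weight module, choosing for each edge of the cycle one of the two
    half-line submodules, every word of degree [g] in the generators must leave
    the chosen half-lines and so kills a vector that [M (γ g)] does not kill. *)

(* Unbundled: the ring structures inferred for bundled morphisms between monoid
   algebras and quotients agree with the canonical ones only up to a conversion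
   that is too expensive for rewriting. *)
Definition ring_map (A B : pzRingType) (f : A -> B) : Prop :=
  [/\ f 0 = 0, f 1 = 1, {morph f : p q / p + q} & {morph f : p q / p * q}].

Lemma ring_map_int (A B : pzRingType) (f : A -> B) (c : int) :
  ring_map f -> f c%:~R = c%:~R.
Proof.
move=> [f0 f1 fD _].
have fN x : f (- x) = - f x.
  by apply: (addrI (f x)); rewrite -fD !subrr f0.
have fn n : f n%:R = n%:R by elim: n => [//|n IHn]; rewrite !mulrS fD f1 IHn.
by case: (intP c) => [|n|n]; rewrite ?fN ?rmorphN /= ?fN fn.
Qed.

(** * The projection onto a quotient ring *)

Section QuotPi.
Variables (A : pzRingType) (S : set A).

Definition quot_pi (x : A) : quot S := \pi_(quot S) x.

Lemma quot_pi_is_zmod_morphism : zmod_morphism quot_pi.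
Proof.
move=> x y; rewrite /quot_pi -[LHS]/(\pi_(quot S) (x - y)).
by rewrite /GRing.add /GRing.opp /= !piE.
Qed.

Lemma quot_pi_is_monoid_morphism : monoid_morphism quot_pi.
Proof.
by split=> [|x y]; rewrite /quot_pi /GRing.one /GRing.mul /= !piE.
Qed.

HB.instance Definition _ := GRing.isZmodMorphism.Build A (quot S) quot_pi
  quot_pi_is_zmod_morphism.
HB.instance Definition _ := GRing.isMonoidMorphism.Build A (quot S) quot_pi
  quot_pi_is_monoid_morphism.

Lemma quot_pi_ring_map : ring_map quot_pi.
Proof.
by split; [exact: rmorph0|exact: rmorph1|exact: rmorphD|exact: rmorphM].
Qed.

Lemma quot_pi_surj (y : quot S) : exists x, y = quot_pi x.
Proof. by exists (repr y); rewrite /quot_pi reprK. Qed.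

Lemma quot_pi_rel x y : S (x - y) -> quot_pi x = quot_pi y.
Proof. by move=> Sxy; apply/eqP/quot_eqP => J [_]; apply. Qed.

End QuotPi.

(** * Homogeneous elements of free algebras *)

Section FreeAlgebra.
Variables (K : nzRingType) (G : choiceType).
Local Notation FA := {malg K[{fmonom G}]}.

Lemma malgUC (w : {fmonom G}) (c : K) : << c *g w >> = c%:MP * << w >> :> FA.
Proof. by rewrite malgM_def fgmulUU mulr1 mul1m. Qed.

Lemma malgU_cons (a : G) (s : seq G) :
  << FMonom (a :: s) >> = fgen K a * << FMonom s >> :> FA.
Proof.
rewrite /fgen malgM_def fgmulUU mulr1; congr << _ >>.
by apply/eqP; rewrite fmP fmM fmU.
Qed.

Variables (D : zmodType) (deg : G -> D).

Lemma free_comp0 d : free_comp deg d (0 : FA).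
Proof. by move=> w; rewrite msupp0. Qed.

Lemma free_compD d (p q : FA) :
  free_comp deg d p -> free_comp deg d q -> free_comp deg d (p + q).
Proof.
move=> hp hq w /(fsubsetP (msuppD_le _ _)); rewrite in_fsetU.
by case/orP=> [/hp|/hq].
Qed.

Lemma free_compM d d' (p q : FA) :
  free_comp deg d p -> free_comp deg d' q -> free_comp deg (d + d') (p * q).
Proof.
move=> hp hq w /msuppM_le[w1 [w2 [/hp <- /hq <- ->]]].
by rewrite /word_deg fmM big_cat.
Qed.

Lemma free_compC (c : K) : free_comp deg 0 (c%:MP : FA).
Proof.
move=> w /(fsubsetP (msuppC_le _)); rewrite in_fset1 => /eqP ->.
by rewrite /word_deg fm1 big_nil.
Qed.

Lemma free_comp_gen (a : G) : free_comp deg (deg a) (fgen K a).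
Proof.
move=> w /(fsubsetP msuppU_le); rewrite in_fset1 => /eqP ->.
by rewrite /word_deg fmU big_seq1.
Qed.

(** Induction principle for homogeneous elements: each is a combination of words of one degree, and
    a word is built by adding letters on the left. Indexing [C] by the degree lets it record where
    [f] sends each component. *)
Lemma free_comp_sub (S : pzRingType) (f : FA -> S) (C : D -> S -> Prop) :
    ring_map f ->
    (forall d, C d 0) ->
    (forall d x y, C d x -> C d y -> C d (x + y)) ->
    (forall d c x, C d x -> C d (f c%:MP * x)) ->
    C 0 1 ->
    (forall d a x, C d x -> C (deg a + d) (f (fgen K a) * x)) ->
  forall d p, free_comp deg d p -> C d (f p).
Proof.
move=> [f0 f1 fD fM] C0 CD CC C1 Cgen.
have Cword (s : seq G) : C (\sum_(a <- s) deg a) (f << FMonom s >>).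
  elim: s => [|a s IHs].
    by rewrite big_nil -fmoneE -[<< _ >>]/(1 : FA) f1.
  by rewrite big_cons malgU_cons fM; exact: Cgen.
move=> d p hp; rewrite [p]monalgE (big_morph f fD f0) big_seq.
apply: (big_ind (C d)) => [||w /hp <-]; [exact: C0|exact: CD|].
by rewrite malgUC fM; apply: CC; rewrite -{2}(fmK w); exact: Cword.
Qed.

End FreeAlgebra.

(** * Products of commuting factors in a noncommutative ring *)

Section CommutingProducts.
Variables (R : pzRingType) (I : eqType).
Implicit Types (s t : seq I) (F H : I -> R).

Lemma comm_prod (x : R) s F : {in s, forall i, GRing.comm x (F i)} ->
  GRing.comm x (\prod_(i <- s) F i).
Proof.
elim: s => [|i s IHs] cx; first by rewrite big_nil; exact: commr1.
rewrite big_cons; apply: commrM; first by apply: cx; rewrite mem_head.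
by apply: IHs => j js; apply: cx; rewrite inE js orbT.
Qed.

Lemma perm_prod_comm s t F : (forall i j, GRing.comm (F i) (F j)) ->
  perm_eq s t -> \prod_(i <- s) F i = \prod_(i <- t) F i.
Proof.
move=> cF; elim: s t => [|i s IHs] t.
  by rewrite perm_sym => /perm_nilP ->.
move=> st; have it : i \in t by rewrite -(perm_mem st) mem_head.
case/splitPr: it st => t1 t2; rewrite perm_sym perm_catC cat_cons.
rewrite perm_cons perm_catC perm_sym => /IHs E.
rewrite big_cons E !big_cat big_cons /= !mulrA; congr (_ * _).
by apply: comm_prod => j _; exact: cF.
Qed.

(** Each [H i] only has to move left past factors [F j] with [j != i], so [F i] and [H i] may fail
    to commute, as powers of x_e and y_e do. *)
Lemma prod_comm_split s F H : uniq s ->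
    (forall i j, i != j -> GRing.comm (F i) (H j)) ->
  \prod_(i <- s) F i * \prod_(i <- s) H i = \prod_(i <- s) (F i * H i).
Proof.
move=> + cFH; elim: s => [|i s IHs]; first by rewrite !big_nil mulr1.
rewrite /= => /andP[is_ us]; rewrite !big_cons -(IHs us) !mulrA.
congr (_ * _); rewrite -!mulrA; congr (_ * _).
symmetry; apply: comm_prod => j js; apply/commr_sym; apply: cFH.
by apply: contraNneq is_ => <-.
Qed.

End CommutingProducts.

(** * Monomials and Euler operators in the Weyl algebra *)

Section WeylTheory.
Variables (k : fieldType) (E : choiceType).
Local Notation W := (weyl k E).
Local Notation x := (@weylx k E).
Local Notation y := (@weyly k E).
Local Notation z := (@weylz k E).
Local Notation ZE := {malg int[E]}.

HB.instance Definition _ :=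
  GRing.RMorphism.copy (@weyl_pi k E) (@quot_pi _ (@weyl_rel k E)).

Lemma weyl_pi_ring_map : ring_map (@weyl_pi k E).
Proof. exact: quot_pi_ring_map. Qed.

Lemma weylC_int (c : int) : weylC E (c%:~R : k) = c%:~R.
Proof. by rewrite /weylC !rmorph_int. Qed.

Lemma weyl_comm_xx e f : GRing.comm (x e) (x f).
Proof.
rewrite /GRing.comm /weylx -!rmorphM; apply: quot_pi_rel.
exact: weyl_rel_xx.
Qed.

Lemma weyl_comm_yy e f : GRing.comm (y e) (y f).
Proof.
rewrite /GRing.comm /weyly -!rmorphM; apply: quot_pi_rel.
exact: weyl_rel_yy.
Qed.

Lemma weyl_yx e f : y e * x f = x f * y e + (e == f)%:R.
Proof.
rewrite /weylx /weyly -!rmorphM -[(e == f)%:R](rmorph_nat (@weyl_pi k E)).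
by rewrite -rmorphD; apply: quot_pi_rel; rewrite opprD addrA; exact: weyl_rel_yx.
Qed.

Lemma weyl_comm_yx e f : e != f -> GRing.comm (y e) (x f).
Proof. by move=> /negbTE ef; rewrite /GRing.comm weyl_yx ef addr0. Qed.

Lemma weyl_xy e : x e * y e = y e * x e - 1.
Proof. by rewrite weyl_yx eqxx addrK. Qed.

Lemma weylz0 e : z e 0 = 1.
Proof. by rewrite /weylz lexx expr0. Qed.

Lemma weylz_nat e (n : nat) : z e n%:Z = x e ^+ n.
Proof. by []. Qed.

Lemma weylz_opp e (n : nat) : z e (- n%:Z) = y e ^+ n.
Proof.
rewrite /weylz abszN absz_nat; case: n => [|n]; first by rewrite oppr0 lexx.
by rewrite oppr_ge0.
Qed.

Lemma comm_weylz e f (p q : int) : e != f -> GRing.comm (z e p) (z f q).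
Proof.
move=> ef; rewrite /weylz; case: ifP => _; case: ifP => _;
  apply/commrX/commr_sym/commrX.
- exact: weyl_comm_xx.
- by apply: weyl_comm_yx; rewrite eq_sym.
- by apply/commr_sym/weyl_comm_yx.
- exact: weyl_comm_yy.
Qed.

(** With [p * q] nonnegative, both factors are powers of the same generator, one of them possibly
    trivial. *)
Lemma weylzD e (p q : int) : 0 <= p * q -> z e p * z e q = z e (p + q).
Proof.
case: (intP p) => [|m|m]; case: (intP q) => [|n|n]; rewrite ?addr0 ?add0r
  ?weylz0 ?mulr1 ?mul1r // => pq.
- by rewrite -PoszD !weylz_nat exprD.
- by rewrite -opprD -PoszD !weylz_opp exprD.
Qed.

(** Edges outside the support contribute [z e 0 = 1] and the factors commute; thus two monomials can
    be written over one common list. *)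
Lemma weyl_monEw (s : seq E) (h : ZE) : uniq s -> {subset msupp h <= s} ->
  weyl_mon k h = \prod_(e <- s) z e h@_e.
Proof.
move=> us hs.
have -> : \prod_(e <- s) z e h@_e = \prod_(e <- s | e \in msupp h) z e h@_e.
  rewrite [RHS]big_mkcond; apply: eq_bigr => e _.
  by case: ifPn => // /mcoeff_outdom ->; rewrite weylz0.
rewrite -big_filter; apply: perm_prod_comm.
  by move=> e f; have [->|/comm_weylz] := eqVneq e f.
apply: uniq_perm; rewrite ?filter_uniq //.
by move=> e; rewrite mem_filter; case: (boolP (e \in msupp h)) => //= /hs ->.
Qed.

Lemma weyl_mon0 : weyl_mon k (0 : ZE) = 1.
Proof. by rewrite /weyl_mon msupp0 big_seq_fset0. Qed.

Lemma weyl_monU e p : weyl_mon k << p *g e >> = z e p.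
Proof.
rewrite (@weyl_monEw [:: e]) ?big_seq1 ?mcoeffUU //.
by move=> f /(fsubsetP msuppU_le); rewrite in_fset1 inE.
Qed.

Lemma weyl_monM (h h' : ZE) : (forall e, 0 <= h@_e * h'@_e) ->
  weyl_mon k h * weyl_mon k h' = weyl_mon k (h + h').
Proof.
move=> hh'; pose s : seq E := (msupp h `|` msupp h')%fset.
rewrite !(@weyl_monEw s) ?fset_uniq //.
- rewrite prod_comm_split ?fset_uniq //; last by move=> *; exact: comm_weylz.
  by apply: eq_bigr => e _; rewrite mcoeffD weylzD.
- exact/fsubsetP/msuppD_le.
- by apply/fsubsetP/fsubsetUr.
- by apply/fsubsetP/fsubsetUl.
Qed.

Lemma comm_weylz_mon e p (h : ZE) : h@_e = 0 -> GRing.comm (z e p) (weyl_mon k h).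
Proof.
move=> he; apply: comm_prod => f; rewrite -mcoeff_neq0 => hf; apply: comm_weylz.
by apply: contraNneq hf => <-; rewrite he.
Qed.

(** Isolates one edge: the remaining monomial has exponent 0 at [e], hence commutes with every
    [z e p]. *)
Lemma weyl_mon_split e (h : ZE) :
  weyl_mon k h = z e h@_e * weyl_mon k (h - << h@_e *g e >>).
Proof.
rewrite -weyl_monU weyl_monM ?subrKC //.
by move=> f; rewrite mcoeffB mcoeffU; case: eqP => [->|]; rewrite ?subrr ?mulr0 ?mul0r.
Qed.

Lemma weyl_monX (h : ZE) n : weyl_mon k h ^+ n = weyl_mon k (h *+ n).
Proof.
elim: n => [|n IHn]; first by rewrite expr0 mulr0n weyl_mon0.
rewrite exprS IHn mulrS weyl_monM // => e.
by rewrite mcoeffMn mulrnAr mulrn_wge0 // -expr2 sqr_ge0.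
Qed.

Section EulerOperator.
Variable e : E.
Local Notation u := (y e * x e).

Lemma weyl_xu : x e * u = (u - 1) * x e.
Proof. by rewrite mulrA weyl_xy. Qed.

Lemma weyl_yu : y e * u = (u + 1) * y e.
Proof. by rewrite mulrDl mul1r -[y e * x e * y e]mulrA weyl_xy mulrBr mulr1 subrK. Qed.

Lemma weyl_xX_shift n (c : int) :
  x e ^+ n * (u + c%:~R) = (u + (c - n%:Z)%:~R) * x e ^+ n.
Proof.
elim: n c => [|n IHn] c; first by rewrite expr0 mul1r mulr1 subr0.
rewrite exprSr -mulrA mulrDr weyl_xu (commr_int (x e) c) -mulrDl addrAC -addrA.
rewrite -[- 1](rmorphN1 intr) -rmorphD /= mulrA IHn.
by rewrite -mulrA -exprSr; congr ((_ + _%:~R) * _); lia.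
Qed.

Lemma weyl_yX_shift n (c : int) :
  y e ^+ n * (u + c%:~R) = (u + (c + n%:Z)%:~R) * y e ^+ n.
Proof.
elim: n c => [|n IHn] c; first by rewrite expr0 mul1r mulr1 addr0.
rewrite exprSr -mulrA mulrDr weyl_yu (commr_int (y e) c) -mulrDl addrAC -addrA.
rewrite -[1](rmorph1 intr) -rmorphD /= mulrA IHn.
by rewrite -mulrA -exprSr; congr ((_ + _%:~R) * _); lia.
Qed.

Lemma weyl_xX_prod n d (c : 'I_n -> int) :
  x e ^+ d * \prod_i (u + (c i)%:~R) =
  \prod_i (u + (c i - d%:Z)%:~R) * x e ^+ d.
Proof.
elim: n c => [|n IHn] c; first by rewrite !big_ord0 mul1r mulr1.
by rewrite !big_ord_recl mulrA weyl_xX_shift -!mulrA IHn.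
Qed.

Lemma weyl_yX_prod n d (c : 'I_n -> int) :
  y e ^+ d * \prod_i (u + (c i)%:~R) =
  \prod_i (u + (c i + d%:Z)%:~R) * y e ^+ d.
Proof.
elim: n c => [|n IHn] c; first by rewrite !big_ord0 mul1r mulr1.
by rewrite !big_ord_recl mulrA weyl_yX_shift -!mulrA IHn.
Qed.

(** As a polynomial in u this has the roots 0, -1, ..., 1 - n, disjoint from the roots 1, ..., n of
    the opposite product in [weyl_xXyX]. The Bezout argument rests on this. *)
Lemma weyl_yXxX n : y e ^+ n * x e ^+ n = \prod_(i < n) (u + (i%:Z)%:~R).
Proof.
elim: n => [|n IHn]; first by rewrite big_ord0 mulr1.
rewrite exprSr exprS -mulrA [y e * _]mulrA big_ord_recr /= -IHn.
have := weyl_xX_shift n n; rewrite subrr addr0 => <-.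
by rewrite mulrA.
Qed.

Lemma weyl_xXyX n : x e ^+ n * y e ^+ n = \prod_(i < n) (u + (- i.+1%:Z)%:~R).
Proof.
elim: n => [|n IHn]; first by rewrite big_ord0 mulr1.
rewrite exprSr exprS -mulrA [x e * _]mulrA weyl_xy big_ord_recr /= -IHn.
have := weyl_yX_shift n (- n.+1%:Z); rewrite -{2}addn1 PoszD opprD addrAC addNr add0r.
by rewrite rmorphN1 => <-; rewrite mulrA.
Qed.

(** A factor appears only for negative [p], where x_e meets a y_e and x_e y_e = u_e - 1. *)
Lemma weylx_z (p : int) : exists c : bool,
  x e * z e p = (if c then u - 1 else 1) * z e (p + 1).
Proof.
have [p0|p0] := leP 0 p.
  by exists false; rewrite mul1r addrC -weylzD // mul1r.
exists true; have {1}-> : p = -1 + (p + 1) by rewrite addrC addrK.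
rewrite -(@weylzD e (-1)); last by rewrite mulN1r oppr_ge0 lezD1.
by rewrite (weylz_opp e 1) mulrA weyl_xy.
Qed.

Lemma weyly_z (p : int) : exists c : bool,
  y e * z e p = (if c then u else 1) * z e (p - 1).
Proof.
have [p0|p0] := leP p 0.
  exists false; rewrite mul1r addrC -(@weylzD e (-1)).
    by rewrite (weylz_opp e 1).
  by rewrite mulN1r oppr_ge0.
exists true; have {1}-> : p = 1 + (p - 1) by rewrite addrC subrK.
by rewrite -(@weylzD e 1); [rewrite mulrA|rewrite mul1r subr_ge0].
Qed.

End EulerOperator.
End WeylTheory.

(** * Comaximal elements of a commutative ring *)

Section Comaximal.
Variable R : comPzRingType.
Implicit Types a b c : R.

Definition comaximal a b := exists p q, p * a + q * b = 1.

Lemma comaximalC a b : comaximal a b -> comaximal b a.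
Proof. by move=> [p [q pq]]; exists q, p; rewrite addrC. Qed.

(** Multiply the two Bezout identities and collect the multiples of [a]. *)
Lemma comaximalM a b c : comaximal a b -> comaximal a c -> comaximal a (b * c).
Proof.
move=> [p [q pq]] [r [s rs]]; exists (p * (r * a + s * c) + q * b * r), (q * s).
have -> : 1 = (p * a + q * b) * (r * a + s * c) by rewrite pq rs mulr1.
ring.
Qed.

Lemma comaximal_prod (I : Type) (s : seq I) a (F : I -> R) :
  (forall i, comaximal a (F i)) -> comaximal a (\prod_(i <- s) F i).
Proof.
move=> aF; apply: (big_ind (comaximal a)) => //; last exact: comaximalM.
by exists 0, 1; rewrite mul0r add0r mulr1.
Qed.

End Comaximal.

(** * Comaximality of shifted variables in k[u] *)

Section PolyRing.
Variables (k : fieldType) (E : choiceType).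
Local Notation RE := {malg k[{cmonom E}]}.

Lemma poly_ind_ops (P : RE -> Prop) :
    (forall p q, P p -> P q -> P (p + q)) ->
    (forall p q, P p -> P q -> P (p * q)) ->
    (forall c : k, P c%:A) -> (forall e, P (polyu k e)) ->
  forall p, P p.
Proof.
move=> PD PM PC PU p.
have P1 : P 1 by rewrite -(scale1r 1); exact: PC.
rewrite (monalgE p); apply: (big_ind P); [|exact: PD|move=> m _].
  by rewrite -(scale0r 1); exact: PC.
rewrite malgUZ -mulr_algl; apply: (PM _ _); first exact: PC.
rewrite -cm_eval_polyu; apply: (big_ind P); [exact: P1|exact: PM|move=> e _].
elim: (m e) => [|n IHn]; first exact: P1.
by rewrite exprS; apply: PM; [exact: PU|exact: IHn].
Qed.

Hypothesis char0 : [pchar k] =i pred0.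

Lemma char0_intr_eq0 (c : int) : (c%:~R == 0 :> k) = (c == 0).
Proof.
have natk n : (n%:R == 0 :> k) = (n == 0%N) by move: n; apply/pcharf0P.
by case: (intP c) => [|n|n]; rewrite ?rmorphN ?oppr_eq0 ?eqxx //; exact: natk.
Qed.

(** The two elements differ by the nonzero integer [a - b], which is invertible in characteristic
    zero. *)
Lemma comaximal_polyu (e : E) (a b : int) : a != b ->
  comaximal (polyu k e + a%:~R) (polyu k e + b%:~R).
Proof.
move=> ab; pose c : k := (a - b)%:~R.
have c0 : c != 0 by rewrite char0_intr_eq0 subr_eq0.
exists (c^-1)%:A, (- (c^-1)%:A); rewrite mulNr -mulrBr opprD addrACA subrr add0r.
rewrite -intrB -(rmorph_int (in_alg RE) (a - b)) -[_%:A]/(in_alg RE _) -rmorphM.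
by rewrite -/c mulVf // rmorph1.
Qed.

Lemma comaximal_polyu_prod (e : E) m n (a : 'I_m -> int) (b : 'I_n -> int) :
    (forall i j, a i != b j) ->
  comaximal (\prod_i (polyu k e + (a i)%:~R)) (\prod_j (polyu k e + (b j)%:~R)).
Proof.
move=> ab; apply: comaximal_prod => j; apply/comaximalC/comaximal_prod => i.
by apply/comaximalC/comaximal_polyu.
Qed.

End PolyRing.

(** * Components of the Weyl algebra as k[u] times a monomial *)

Section WeylComponents.
Variables (k : fieldType) (E : choiceType).
Local Notation W := (weyl k E).
Local Notation RE := {malg k[{cmonom E}]}.
Local Notation x := (@weylx k E).
Local Notation y := (@weyly k E).
Local Notation z := (@weylz k E).
Local Notation ZE := {malg int[E]}.
(** Stands for the restriction of the canonical representation to the base ring k[u]. *)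
Variable psi : RE -> W.
Hypothesis psi_ring_map : ring_map psi.
Hypothesis psiC : forall c : k, psi c%:A = weylC E c.
Hypothesis psiU : forall e, psi (polyu k e) = y e * x e.

Let psi0 : psi 0 = 0. Proof. by case: psi_ring_map. Qed.
Let psi1 : psi 1 = 1. Proof. by case: psi_ring_map. Qed.
Let psiD : {morph psi : p q / p + q}. Proof. by case: psi_ring_map. Qed.
Let psiM : {morph psi : p q / p * q}. Proof. by case: psi_ring_map. Qed.

Let psi_int (c : int) : psi c%:~R = c%:~R.
Proof. by rewrite -(rmorph_int (in_alg RE)) psiC weylC_int. Qed.

Let psiUD e (c : int) : psi (polyu k e + c%:~R) = y e * x e + c%:~R.
Proof. exact: etrans (psiD _ _) (congr2 +%R (psiU e) (psi_int c)). Qed.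

Lemma weyl_comp0 h : weyl_comp h (0 : W).
Proof. by exists 0; [exact: free_comp0 | rewrite rmorph0]. Qed.

Lemma weyl_compD h (S T : W) :
  weyl_comp h S -> weyl_comp h T -> weyl_comp h (S + T).
Proof.
by move=> [p hp <-] [q hq <-]; exists (p + q); rewrite ?rmorphD //; exact: free_compD.
Qed.

Lemma weyl_compM h h' (S T : W) :
  weyl_comp h S -> weyl_comp h' T -> weyl_comp (h + h') (S * T).
Proof.
by move=> [p hp <-] [q hq <-]; exists (p * q); rewrite ?rmorphM //; exact: free_compM.
Qed.

Lemma weyl_compC c : weyl_comp 0 (weylC E c : W).
Proof. by exists c%:MP => //; exact: free_compC. Qed.

Lemma weyl_comp1 : weyl_comp 0 (1 : W).
Proof. by have := weyl_compC 1; rewrite /weylC mpolyC1E rmorph1. Qed.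

Lemma weyl_compx e : weyl_comp << e >> (x e).
Proof. by exists (weyl_freex k e) => //; exact: (free_comp_gen (@weyl_deg E)). Qed.

Lemma weyl_compy e : weyl_comp (- << e >>) (y e).
Proof. by exists (weyl_freey k e) => //; exact: (free_comp_gen (@weyl_deg E)). Qed.

Lemma weyl_compX h n (T : W) : weyl_comp h T -> weyl_comp (h *+ n) (T ^+ n).
Proof.
move=> hT; elim: n => [|n IHn]; first exact: weyl_comp1.
by rewrite exprS mulrS; exact: weyl_compM.
Qed.

Lemma weyl_compz e p : weyl_comp << p *g e >> (z e p).
Proof.
have En n : << n%:Z *g e >> = << e >> *+ n :> ZE.
  by rewrite -monalgUMn pmulrn intz.
case: (intP p) => [|n|n]; first by rewrite monalgU0 weylz0; exact: weyl_comp1.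
  by rewrite weylz_nat En; exact/weyl_compX/weyl_compx.
by rewrite weylz_opp monalgUN En -mulNrn; exact/weyl_compX/weyl_compy.
Qed.

Lemma weyl_comp_mon (h : ZE) : weyl_comp h (weyl_mon k h).
Proof.
rewrite {1}[h]monalgE /weyl_mon.
apply: (big_rec2 (@weyl_comp k E)) => [|e S T _]; first exact: weyl_comp1.
exact/weyl_compM/weyl_compz.
Qed.

Lemma weyl_comp_psi r : weyl_comp 0 (psi r).
Proof.
elim/poly_ind_ops: r => [p q hp hq|p q hp hq|c|e].
- by rewrite psiD; exact: weyl_compD.
- by rewrite psiM -[0]addr0; exact: weyl_compM.
- by rewrite psiC; exact: weyl_compC.
- by rewrite psiU -(addNr << e >>); exact/weyl_compM/weyl_compx/weyl_compy.
Qed.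

(** The polynomials that can be moved past [T] are closed under sums and products, so constants and
    variables suffice. *)
Lemma psi_twist (T : W) :
    (forall c : k, GRing.comm T (weylC E c)) ->
    (forall e, exists r, T * (y e * x e) = psi r * T) ->
  forall p, exists q, T * psi p = psi q * T.
Proof.
move=> TC TU; elim/poly_ind_ops => [p q|p q|c|e].
- move=> [p' hp] [q' hq]; exists (p' + q').
  by rewrite !psiD mulrDr mulrDl hp hq.
- move=> [p' hp] [q' hq]; exists (p' * q').
  apply: (etrans (y := psi p' * psi q' * T)); last by rewrite psiM.
  by rewrite psiM mulrA hp -mulrA hq mulrA.
- by exists c%:A; rewrite psiC; exact: TC.
- by rewrite psiU; exact: TU.
Qed.

Lemma comm_weylC c (T : W) : GRing.comm T (weylC E c).
Proof.
have [p ->] := quot_pi_surj T; have [_ _ _ piM] := weyl_pi_ring_map k E.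
apply: etrans (esym (piM _ _)) (etrans _ (piM _ _)); apply: (congr1 (@weyl_pi k E)).
rewrite !malgM_def fgmulUg fgmulgU; apply: eq_bigr => w _.
by rewrite mulm1 mul1m mulrC.
Qed.

(** Moving x_e or y_e to the right replaces u_e by u_e - 1 or u_e + 1; the other Euler operators
    commute with the letter. *)
Lemma weyl_letter_psi (a : weyl_letter E) p :
  exists q, weyl_pi (fgen k a) * psi p = psi q * weyl_pi (fgen k a).
Proof.
apply: psi_twist => [c|f]; first exact: comm_weylC.
case: a => e; [rewrite -[weyl_pi _]/(weylx k e)|rewrite -[weyl_pi _]/(weyly k e)].
- have [->|fe] := eqVneq f e; last first.
    exists (polyu k f); rewrite psiU; apply: commrM; last exact: weyl_comm_xx.
    exact/commr_sym/weyl_comm_yx.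
  by exists (polyu k e + (-1)%:~R); rewrite psiUD weyl_xu.
- have [->|fe] := eqVneq f e; last first.
    exists (polyu k f); rewrite psiU; apply: commrM; first exact: weyl_comm_yy.
    by apply: weyl_comm_yx; rewrite eq_sym.
  by exists (polyu k e + 1%:~R); rewrite psiUD weyl_yu.
Qed.

Lemma weyl_letter_mon (a : weyl_letter E) h :
  exists q, weyl_pi (fgen k a) * weyl_mon k h = psi q * weyl_mon k (weyl_deg a + h).
Proof.
have rest e p : h + << p *g e >> - << (h + << p *g e >>)@_e *g e >> =
                h - << h@_e *g e >>.
  by rewrite mcoeffD mcoeffUU monalgUD opprD addrACA subrr addr0.
case: a => e; [rewrite -[weyl_pi _]/(weylx k e)|rewrite -[weyl_pi _]/(weyly k e)].
- have [c xz] := weylx_z k e h@_e; exists (if c then polyu k e + (-1)%:~R else 1).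
  rewrite (weyl_mon_split k e h) mulrA xz -mulrA.
  have -> : weyl_deg (inl e) + h = h + << 1 *g e >> by exact: addrC.
  rewrite (weyl_mon_split k e (h + << 1 *g e >>)) rest mcoeffD mcoeffUU; congr (_ * _).
  by case: (c); [rewrite psiUD|rewrite psi1].
- have [c yz] := weyly_z k e h@_e; exists (if c then polyu k e else 1).
  rewrite (weyl_mon_split k e h) mulrA yz -mulrA.
  have -> : weyl_deg (inr e) + h = h + << -1 *g e >>.
    by rewrite monalgUN; exact: addrC.
  rewrite (weyl_mon_split k e (h + << -1 *g e >>)) rest mcoeffD mcoeffUU; congr (_ * _).
  by case: (c); [rewrite psiU|rewrite psi1].
Qed.

(** Letter by letter: a new letter on the left passes the polynomial coefficient and is absorbed
    into the monomial, at the cost of another polynomial. *)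
Lemma weyl_comp_normal h (T : W) :
  weyl_comp h T -> exists r, T = psi r * weyl_mon k h.
Proof.
move=> [p hp <-].
pose C (h : ZE) (T : W) := exists r, T = psi r * weyl_mon k h.
apply: (free_comp_sub (C := C) (weyl_pi_ring_map k E)) hp; rewrite /C.
- by move=> d; exists 0; rewrite psi0 mul0r.
- by move=> d S T' [r ->] [s ->]; exists (r + s); rewrite psiD mulrDl.
- move=> d c T' [r ->]; exists (c%:A * r).
  by rewrite psiM psiC mulrA.
- by exists 1; rewrite psi1 weyl_mon0 mulr1.
- move=> d a T' [r ->]; have [q aq] := weyl_letter_psi a r.
  have [s as_] := weyl_letter_mon a d; exists (q * s).
  by rewrite mulrA aq -mulrA as_ mulrA psiM.
Qed.

Hypothesis char0 : [pchar k] =i pred0.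

(* The two products are multiples of [z e (m - n)] by polynomials in the Euler
   operator [y e * x e] whose roots are disjoint sets of integers. *)
Lemma weylz_bezout_nat e (m n : nat) : exists p q,
  psi p * (x e ^+ m * y e ^+ n) + psi q * (y e ^+ n * x e ^+ m) =
  z e (m%:Z - n%:Z).
Proof.
have psiP l (c : 'I_l -> int) : \prod_i (y e * x e + (c i)%:~R) =
    psi (\prod_i (polyu k e + (c i)%:~R)).
  rewrite (big_morph psi psiM psi1); apply: eq_bigr => i _.
  exact/esym/psiUD.
have [le_nm|lt_mn] := leqP n m.
- pose d := (m - n)%N; have md : m = (d + n)%N by rewrite subnK.
  (* Here x^m y^n = x^d (x^n y^n), and moving x^d to the right lowers the constants by [d]. They
     stay negative, while those of y^n x^n are nonnegative. *)
  have [i j|p [q pq]] := @comaximal_polyu_prod k E char0 e n n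
    (fun i => - i.+1%:Z - d%:Z) (fun i => i%:Z); first by lia.
  exists p, q; have -> : m%:Z - n%:Z = d%:Z by lia.
  have -> : x e ^+ m * y e ^+ n =
      psi (\prod_(i < n) (polyu k e + (- i.+1%:Z - d%:Z)%:~R)) * x e ^+ d.
    by rewrite md exprD -mulrA weyl_xXyX weyl_xX_prod psiP.
  have -> : y e ^+ n * x e ^+ m =
      psi (\prod_(i < n) (polyu k e + (i%:Z)%:~R)) * x e ^+ d.
    by rewrite md addnC exprD mulrA weyl_yXxX psiP.
  by rewrite weylz_nat !mulrA -mulrDl -(psiM p) -(psiM q) -psiD pq psi1 mul1r.
- pose d := (n - m)%N; have nd : n = (m + d)%N by rewrite subnKC // ltnW.
  (* Now y^d moves to the right past y^m x^m and raises its nonnegative constants by [d]; those of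
     x^m y^m are negative. *)
  have [i j|p [q pq]] := @comaximal_polyu_prod k E char0 e m m
    (fun i => - i.+1%:Z) (fun i => i%:Z + d%:Z); first by lia.
  exists p, q; have -> : m%:Z - n%:Z = - d%:Z by lia.
  have -> : x e ^+ m * y e ^+ n =
      psi (\prod_(i < m) (polyu k e + (- i.+1%:Z)%:~R)) * y e ^+ d.
    by rewrite nd exprD mulrA weyl_xXyX psiP.
  have -> : y e ^+ n * x e ^+ m =
      psi (\prod_(i < m) (polyu k e + (i%:Z + d%:Z)%:~R)) * y e ^+ d.
    by rewrite nd addnC exprD -mulrA weyl_yXxX weyl_yX_prod psiP.
  by rewrite weylz_opp !mulrA -mulrDl -(psiM p) -(psiM q) -psiD pq psi1 mul1r.
Qed.

(** For exponents of opposite signs this is [weylz_bezout_nat], with the two coefficients exchanged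
    when [a] is the negative one. *)
Lemma weylz_bezout e (a b : int) : exists p q,
  psi p * (z e a * z e b) + psi q * (z e b * z e a) = z e (a + b).
Proof.
have [ab|] := leP 0 (a * b).
  by exists 1, 0; rewrite psi1 psi0 mul0r addr0 mul1r weylzD.
case: (intP a) => [|m|m]; case: (intP b) => [|n|n] //; rewrite ?mul0r ?mulr0 // => _.
- by have := weylz_bezout_nat e m.+1 n.+1; rewrite -weylz_nat -weylz_opp.
- have [p [q pq]] := weylz_bezout_nat e n.+1 m.+1; exists q, p.
  by rewrite addrC weylz_nat weylz_opp pq addrC.
Qed.

End WeylComponents.

(** * The incidence matrix *)

Section IncidenceTheory.
Variables (V E : choiceType) (Γ : multiquiver V E).
Local Notation γ := (incid_map Γ).

Lemma mult_at_Some (o : option (V * posnat)) v n :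
  mult_at o v = Some n -> exists2 m : posnat, o = Some (v, m) & n = val m.
Proof. by case: o => [[w m]|] //=; case: eqP => // -> [<-]; exists m. Qed.

Lemma incid_tgt e v n : qtgt Γ e = Some (v, n) -> incid Γ e v = (val n)%:Z.
Proof. by rewrite /incid => -> /=; rewrite eqxx. Qed.

(** [incid] looks at the target first; the absence of loops makes that test fail. *)
Lemma incid_src e v n : qsrc Γ e = Some (v, n) -> incid Γ e v = - (val n)%:Z.
Proof.
move=> es; rewrite /incid es /= eqxx.
case et: (mult_at (qtgt Γ e) v) => [m|] //.
have [m' /(q_noloop es)] := mult_at_Some et; by case.
Qed.

Lemma incid_neq0 e v : incid Γ e v != 0 ->
  (exists n, qsrc Γ e = Some (v, n)) \/ (exists n, qtgt Γ e = Some (v, n)).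
Proof.
rewrite /incid; case et: (mult_at (qtgt Γ e) v) => [m|].
  by have [m' -> _] := mult_at_Some et; right; exists m'.
case es: (mult_at (qsrc Γ e) v) => [m|]; last by rewrite eqxx.
by have [m' -> _] := mult_at_Some es; left; exists m'.
Qed.

Lemma qjoins_neq e v w : qjoins Γ e v w -> v <> w.
Proof.
by move=> [m [n [[es et]|[es et]]]]; have := q_noloop es et => // + /esym.
Qed.

Lemma qjoins_ends e v w v' w' : qjoins Γ e v w -> qjoins Γ e v' w' ->
  (v = v' /\ w = w') \/ (v = w' /\ w = v').
Proof.
by move=> [m [n [[es et]|[es et]]]] [m' [n' [[]|[]]]];
  rewrite es et => -[<- _] [<- _]; auto.
Qed.

Lemma incid_neq0_qjoins e v w :
  v != w -> incid Γ e v != 0 -> incid Γ e w != 0 -> qjoins Γ e v w.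
Proof.
move=> vw /incid_neq0[] [m em] /incid_neq0[] [n en].
- by move: en vw; rewrite em => -[->]; rewrite eqxx.
- by exists m, n; left.
- by exists n, m; right.
- by move: en vw; rewrite em => -[->]; rewrite eqxx.
Qed.

Lemma qjoins_incid e v w : qjoins Γ e v w ->
  exists a b : nat, [/\ (0 < a)%N, (0 < b)%N &
    (incid Γ e v = a%:Z /\ incid Γ e w = - b%:Z) \/
    (incid Γ e v = - a%:Z /\ incid Γ e w = b%:Z)].
Proof.
move=> [m [n [[es et]|[es et]]]]; [exists (val m), (val n)|exists (val n), (val m)];
  rewrite (incid_src es) (incid_tgt et) !(valP m) !(valP n); split=> //; auto.
Qed.

Lemma qjoins_incid_other e v w a :
  qjoins Γ e v w -> a != v -> a != w -> incid Γ e a = 0.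
Proof.
move=> evw av aw; apply: contraNeq (av) => ea.
have ev : incid Γ e v != 0.
  by have [m [n [m0 n0 [[-> _]|[-> _]]]]] := qjoins_incid evw; lia.
have [[va _]|[_ wa]] := qjoins_ends evw (incid_neq0_qjoins av ea ev).
  by rewrite va.
by move: aw; rewrite wa eqxx.
Qed.

(** Local finiteness turns the defining sum into a finite one over the edges at [v]. *)
Lemma incid_vertexE v e : (incid_vertex Γ v)@_e = incid Γ e v.
Proof.
have fA := q_locfin Γ v; set A := [set _ | _] in fA.
rewrite /incid_vertex (fsbigTE (fset_set A)) => [|f]; last first.
  rewrite in_fset_set // => /negP fA'; have [->|/incid_neq0 h] := eqVneq (incid Γ f v) 0.
    by rewrite monalgU0.
  by case: fA'; rewrite inE.
rewrite raddf_sum /=; under eq_bigr do rewrite mcoeffU.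
have [eA|eA] := boolP (e \in fset_set A).
  rewrite (big_fsetD1 e) //= eqxx big1_fset ?addr0 // => f.
  by rewrite in_fsetD1 => /andP[/negbTE ->].
rewrite big1_fset => [|f fA' _]; last first.
  by case: eqP fA' => // ->; rewrite (negbTE eA).
rewrite in_fset_set // in eA; move/negP: eA => eA.
by apply/esym/eqP/negPn/negP => /incid_neq0 h; apply: eA; rewrite inE.
Qed.

Lemma incid_map_coefw (s : seq V) (g : {malg int[V]}) e :
    uniq s -> {subset msupp g <= s} ->
  (γ g)@_e = \sum_(v <- s) incid Γ e v * g@_v.
Proof.
move=> us gs; rewrite /incid_map raddf_sum /=.
have -> : \sum_(v <- s) incid Γ e v * g@_v =
          \sum_(v <- s | v \in msupp g) incid Γ e v * g@_v.
  rewrite [RHS]big_mkcond; apply: eq_bigr => v _.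
  by case: ifPn => // /mcoeff_outdom ->; rewrite mulr0.
rewrite -[RHS]big_filter; have st : perm_eq [seq v <- s | v \in msupp g] (msupp g).
  apply: uniq_perm; rewrite ?filter_uniq // => v.
  by rewrite mem_filter; case: (boolP (v \in msupp g)) => //= /gs ->.
rewrite (perm_big _ st) /=; apply: eq_bigr => v _.
by rewrite raddfMz /= incid_vertexE mulrzz.
Qed.

(** Only the two ends of [e] have a nonzero entry in its row. *)
Lemma qjoins_incid_map e v w g : qjoins Γ e v w ->
  (γ g)@_e = incid Γ e v * g@_v + incid Γ e w * g@_w.
Proof.
move=> evw; have vw : v != w by apply/eqP; exact: qjoins_neq evw.
pose s := [seq a <- msupp g | (a != v) && (a != w)].
rewrite (@incid_map_coefw [:: v, w & s]).
- rewrite !big_cons addrA big_seq big1 ?addr0 // => a.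
  rewrite mem_filter => /andP[/andP[av aw] _].
  by rewrite (qjoins_incid_other evw av aw) mul0r.
- by rewrite /= inE !mem_filter !eqxx (negbTE vw) andbF filter_uniq.
- by move=> a ag; rewrite !inE mem_filter ag andbT; case: (a == v); case: (a == w).
Qed.

Lemma incid_mapD g g' : γ (g + g') = γ g + γ g'.
Proof.
apply/malgP => e; pose s : seq V := (msupp g `|` msupp g')%fset.
rewrite mcoeffD !(@incid_map_coefw s) ?fset_uniq //.
- by rewrite -big_split; apply: eq_bigr => v _; rewrite mcoeffD mulrDr.
- by apply/fsubsetP/fsubsetUr.
- by apply/fsubsetP/fsubsetUl.
- exact/fsubsetP/msuppD_le.
Qed.

Lemma incid_map0 : γ 0 = 0.
Proof. by apply: (addrI (γ 0)); rewrite -incid_mapD !addr0. Qed.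

Lemma incid_mapU v c : γ << c *g v >> = incid_vertex Γ v *~ c.
Proof.
apply/malgP => e; rewrite (@incid_map_coefw [:: v]) //.
  by rewrite big_seq1 mcoeffUU raddfMz /= incid_vertexE mulrzz.
by move=> w /(fsubsetP msuppU_le); rewrite in_fset1 inE.
Qed.

End IncidenceTheory.

(** * Leaves in finite vertex sets of acyclic graphs *)

Section Leaf.
Variables (V E : choiceType) (Γ : multiquiver V E).

(* Otherwise a non-backtracking walk in [S] can be continued forever, and its
   first return to a visited vertex closes a cycle. *)
Lemma acyclic_leaf (S : seq V) : qacyclic Γ -> S != [::] ->
  exists2 v, v \in S & forall e e' w w', w \in S -> w' \in S ->
    qjoins Γ e v w -> qjoins Γ e' v w' -> e = e'.
Proof.
move=> acyc S0; apply: contrapT => noleaf.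
have step v e : v \in S -> exists p : V * E,
    [/\ p.1 \in S, p.2 <> e & qjoins Γ p.2 v p.1].
  move=> vS; apply: contrapT => nostep; apply: noleaf; exists v => //.
  have edge f w : w \in S -> qjoins Γ f v w -> f = e.
    by move=> wS fvw; apply: contrapT => fe; apply: nostep; exists (w, f).
  by move=> f f' w w' wS w'S /(edge _ _ wS) -> /(edge _ _ w'S) ->.
have [v0 v0S] : exists v, v \in S 
  by case: (S) S0 => // v S' _; exists v; rewrite mem_head.
(* The walk needs some edge to start from; without edges every vertex would be a leaf. *)
have [e0 _] : exists e : E, True.
  apply: contrapT => noE; apply: noleaf; exists v0 => // e.
  by case: noE; exists e.
(* A state is the current vertex with the edge just used, which the next edge must avoid. *)
have /choice[nxt nxtP] : forall p : V * E, exists q : V * E, p.1 \in S ->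
    [/\ q.1 \in S, q.2 <> p.2 & qjoins Γ q.2 p.1 q.1].
  move=> [v e]; have [vS|vS] := boolP (v \in S); last by exists (v, e).
  by have [q qP] := step v e vS; exists q.
pose st n := iter n nxt (v0, e0); pose vs n := (st n).1; pose es n := (st n.+1).2.
have vsS n : vs n \in S.
  elim: n => [//|n IHn]; by have [] := nxtP _ IHn.
have joins n : qjoins Γ (es n) (vs n) (vs n.+1) by have [] := nxtP _ (vsS n).
have es_neq n : es n.+1 <> es n by have [] := nxtP _ (vsS n.+1).
have : exists j, [exists i : 'I_j, vs i == vs j].
  apply: contrapT => norep.
  have us : uniq [seq vs i | i <- iota 0 (size S).+1].
    apply/(uniqP v0) => a b; rewrite !inE size_map size_iota => aS bS.
    rewrite !(nth_map 0%N) ?size_iota // !nth_iota // !add0n => ab.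
    apply: contrapT => /eqP; rewrite neq_ltn => /orP[lt|lt]; apply: norep.
      by exists b; apply/existsP; exists (Ordinal lt); rewrite /= ab.
    by exists a; apply/existsP; exists (Ordinal lt); rewrite /= ab.
  have /(uniq_leq_size us) : {subset [seq vs i | i <- iota 0 (size S).+1] <= S}.
    by move=> _ /mapP[i _ ->].
  by rewrite size_map size_iota ltnn.
(* With [j] the first return time and [i] the earlier visit, minimality makes the vertices before
   time [j] distinct. *)
case/ex_minnP => j /existsP[i /eqP ij] minj.
have vs_inj a b : (a < j)%N -> (b < j)%N -> vs a = vs b -> a = b.
  move=> aj bj ab; apply: contrapT => /eqP; rewrite neq_ltn => /orP[lt|lt].
    have /minj : [exists i : 'I_b, vs i == vs b].
      by apply/existsP; exists (Ordinal lt); rewrite /= ab.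
    by rewrite leqNgt bj.
  have /minj : [exists i : 'I_a, vs i == vs a].
    by apply/existsP; exists (Ordinal lt); rewrite /= ab.
  by rewrite leqNgt aj.
have lt_ij := ltn_ord i.
(* Equal edges have the same ends. Distinctness of the vertices then leaves only the case where [b]
   is [a.+1], which is a backtrack. *)
have es_inj a b : (i <= a)%N -> (a < b)%N -> (b < j)%N -> es a <> es b.
  move=> ia ab bj eab; have := joins b; rewrite -eab => jb.
  have [[/vs_inj]|[]] := qjoins_ends (joins a) jb; first by lia.
  have [bj1|bj1] := eqVneq b.+1 j; last by move/vs_inj; lia.
  rewrite bj1 -ij => /vs_inj ai /vs_inj a1b.
  have Eb : b = a.+1 by rewrite -a1b; lia.
  by apply: (es_neq a); rewrite -Eb.
apply: acyc; exists (j - i)%N, (fun t => vs (i + t)%N), (fun t => es (i + t)%N).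
split.
- have : i.+1 <> j by move=> i1; apply: (qjoins_neq (joins i)); rewrite i1.
  by lia.
- move=> a b /vs_inj ab; apply/val_inj/(@addnI i)/ab.
    by have := ltn_ord a; lia.
  by have := ltn_ord b; lia.
- move=> a b eab; apply: contrapT => /eqP; rewrite -val_eqE neq_ltn /=.
  have := ltn_ord a; have := ltn_ord b => bj aj /orP[lt|lt].
    by apply: es_inj eab; lia.
  by apply: es_inj (esym eab); lia.
(* The last edge closes the cycle because [vs j = vs i]. *)
- move=> t; have := joins (i + t)%N; rewrite -addnS /=.
  have [lt|ge] := ltnP t.+1 (j - i); first by rewrite modn_small.
  have -> : t.+1 = (j - i)%N by have := ltn_ord t; lia.
  by rewrite modnn addn0 subnKC ?ij // ltnW.
Qed.

End Leaf.

(** * Weight modules and their half-line submodules *)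

Section WeylAction.
Variables (k : fieldType) (E : choiceType) (eps : E -> bool).
Local Notation W := (weyl k E).
Local Notation ZE := {malg int[E]}.
Local Notation weight_fun := (ZE -> k).
Implicit Types (F : weight_fun) (n : ZE) (e f : E) (s : seq (weyl_letter E)).

(* On weight functions, [x_e] raises and [y_e] lowers weights by [e].  Where
   [eps e] holds this is the module k[x_e, x_e^-1], with the submodule k[x_e] of
   functions vanishing at negative weights; elsewhere it is its Fourier
   transform, with the submodule of functions vanishing at weights >= 0. *)
Definition letter_act (a : weyl_letter E) F n : k :=
  match a with
  | inl e => (if eps e then 1 else (n@_e)%:~R) * F (n - << e >>)
  | inr e => (if eps e then (n@_e + 1)%:~R else 1) * F (n + << e >>)
  end.

Definition word_act s F : weight_fun := foldr letter_act F s.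

Definition free_act (p : weyl_free k E) F n : k :=
  \sum_(w <- msupp p) p@_w * word_act w F n.

Lemma letter_actZ a c F n :
  letter_act a (fun m => c * F m) n = c * letter_act a F n.
Proof. by case: a => e /=; rewrite mulrCA. Qed.

Lemma letter_act_sum (I : Type) (r : seq I) (G : I -> weight_fun) a n :
  letter_act a (fun m => \sum_(i <- r) G i m) n =
  \sum_(i <- r) letter_act a (G i) n.
Proof. by case: a => e /=; rewrite mulr_sumr. Qed.

Lemma word_actZ s c F : word_act s (fun m => c * F m) = fun n => c * word_act s F n.
Proof.
elim: s => [//|a s IHs]; apply/funext => n /=.
by rewrite IHs letter_actZ.
Qed.

Lemma word_act_sum (I : Type) (r : seq I) (G : I -> weight_fun) s :
  word_act s (fun m => \sum_(i <- r) G i m) =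
  fun n => \sum_(i <- r) word_act s (G i) n.
Proof.
elim: s => [//|a s IHs]; apply/funext => n /=.
by rewrite IHs letter_act_sum.
Qed.

Lemma free_actE p F n :
  free_act p F n = mmap idfun (fun w : {fmonom _} => word_act w F n) p.
Proof. by []. Qed.

Lemma free_actB p q F n : free_act (p - q) F n = free_act p F n - free_act q F n.
Proof. by rewrite !free_actE mmapB. Qed.

Lemma free_actD p q F n : free_act (p + q) F n = free_act p F n + free_act q F n.
Proof. by rewrite !free_actE mmapD. Qed.

Lemma free_act0 F n : free_act 0 F n = 0.
Proof. by rewrite free_actE mmap0. Qed.

Lemma free_actU c (w : {fmonom _}) F n :
  free_act << c *g w >> F n = c * word_act w F n.
Proof. by rewrite free_actE mmapU. Qed.

Lemma free_actC c F n : free_act c%:MP F n = c * F n.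
Proof. by rewrite free_actU fm1. Qed.

Lemma free_act_gen a F n : free_act (fgen k a) F n = letter_act a F n.
Proof. by rewrite free_actU fmU mul1r. Qed.

Lemma free_actM p q F n : free_act (p * q) F n = free_act p (free_act q F) n.
Proof.
rewrite free_actE malgME raddf_sum; apply: eq_bigr => w _.
rewrite raddf_sum /= /free_act word_act_sum mulr_sumr; apply: eq_bigr => w' _.
rewrite -free_actE free_actU fmM word_actZ mulrA; congr (_ * _).
by rewrite /word_act foldr_cat.
Qed.

Lemma free_act_gen2 a b F n :
  free_act (fgen k a * fgen k b) F n = letter_act a (letter_act b F) n.
Proof.
rewrite free_actM free_act_gen; congr (letter_act _ _ _).
by apply/funext => m; rewrite free_act_gen.
Qed.

Lemma free_act_comm a b F n :
  free_act (fgen k a * fgen k b - fgen k b * fgen k a) F n =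
  letter_act a (letter_act b F) n - letter_act b (letter_act a F) n.
Proof.
apply: etrans (free_actB _ _ _ _) _.
exact: (congr2 (fun c d : k => c - d) (free_act_gen2 _ _ _ _) (free_act_gen2 _ _ _ _)).
Qed.

(** For either value of [eps], at a weight with e-coordinate m, y_e x_e multiplies by m + 1 and x_e
    y_e by m; letters at different edges commute. *)
Lemma free_act_rel p F n : weyl_rel p -> free_act p F n = 0.
Proof.
have coefB e f : (n - << e >>)@_f = n@_f - (e == f)%:R by rewrite mcoeffB mcoeffU.
have coefD e f : (n + << e >>)@_f = n@_f + (e == f)%:R by rewrite mcoeffD mcoeffU.
case=> e f.
- rewrite free_act_comm /= !coefB [f == e]eq_sym.
  have [->|ef] := eqVneq e f; first by rewrite subrr.
  by rewrite !subr0 [n - << f >> - _]addrAC mulrCA subrr.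
- rewrite free_act_comm /= !coefD [f == e]eq_sym.
  have [->|ef] := eqVneq e f; first by rewrite subrr.
  by rewrite !addr0 [n + << f >> + _]addrAC mulrCA subrr.
- rewrite free_actB free_act_comm -mpolyC_nat free_actC /= coefB coefD [f == e]eq_sym.
  have [->|ef] := eqVneq e f.
    rewrite addrK subrK /= !mulr1n; case: (eps f); rewrite ?subrK intrD !mulr1z; ring.
  by rewrite addr0 subr0 mul0r subr0 [n - << f >> + _]addrAC mulrCA subrr.
Qed.

Definition weyl_act (S : W) F n : k := free_act (repr S) F n.

(** Independence of the representative: the elements acting as zero on all weight functions form a
    two-sided ideal containing the relations. *)
Lemma weyl_act_pi p F n : weyl_act (weyl_pi p) F n = free_act p F n.
Proof.
pose J : set (weyl_free k E) := [set p | forall F n, free_act p F n = 0].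
have JI : is_ideal J.
  split=> [F' n'|p' q Jp Jq F' n'|q p' Jp F' n'|q p' Jp F' n'].
  - by rewrite free_act0.
  - by rewrite free_actB Jp Jq subrr.
  - rewrite free_actM; have -> : free_act p' F' = fun=> 0.
      by apply/funext => m; exact: Jp.
    have := word_actZ; rewrite /free_act => wZ; rewrite big1 // => w _.
    have -> : (fun=> 0) = (fun m : ZE => 0 * F' m) by apply/funext => m; rewrite mul0r.
    by rewrite wZ mul0r mulr0.
  - by rewrite free_actM Jp.
have Jrel : @weyl_rel k E `<=` J by move=> q qr F' n'; exact: free_act_rel.
have /(_ F n) : J (p - repr (weyl_pi p)) 
  by apply: (@quot_repr _ (@weyl_rel k E) p J); split.
by rewrite free_actB => /eqP; rewrite subr_eq0 => /eqP ->.
Qed.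

Lemma weyl_actD S S' F n : weyl_act (S + S') F n = weyl_act S F n + weyl_act S' F n.
Proof.
have [p ->] := quot_pi_surj S; have [q ->] := quot_pi_surj S'.
have [_ _ piD _] := weyl_pi_ring_map k E.
by rewrite -piD !weyl_act_pi free_actD.
Qed.

Lemma weyl_actM S S' F n : weyl_act (S * S') F n = weyl_act S (weyl_act S' F) n.
Proof.
have [p ->] := quot_pi_surj S; have [q ->] := quot_pi_surj S'.
have [_ _ _ piM] := weyl_pi_ring_map k E.
rewrite -piM !weyl_act_pi free_actM; congr (free_act _ _ _).
by apply/funext => m; rewrite weyl_act_pi.
Qed.

Lemma weyl_actC c F n : weyl_act (weylC E c) F n = c * F n.
Proof. by rewrite weyl_act_pi free_actC. Qed.

Lemma weyl_act1 F n : weyl_act 1 F n = F n.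
Proof.
have [_ pi1 _ _] := weyl_pi_ring_map k E.
by rewrite -pi1 weyl_act_pi -mpolyC1E free_actC mul1r.
Qed.

Lemma weyl_act0 F n : weyl_act 0 F n = 0.
Proof.
have [pi0 _ _ _] := weyl_pi_ring_map k E.
by rewrite -pi0 weyl_act_pi free_act0.
Qed.

Lemma weyl_act_gen a F n : weyl_act (weyl_pi (fgen k a)) F n = letter_act a F n.
Proof. by rewrite weyl_act_pi free_act_gen. Qed.

(** The factor [c] must not depend on [F]: the value of the result at [n] is determined by the value
    of [F] at the single weight [n - h]. *)
Definition weyl_shift (h : ZE) (S : W) : Prop :=
  exists c : ZE -> k, forall F n, weyl_act S F n = c n * F (n - h).

Lemma weyl_comp_shift h S : weyl_comp h S -> weyl_shift h S.
Proof.
move=> [p hp <-].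
apply: (free_comp_sub (C := weyl_shift) (weyl_pi_ring_map k E)) hp.
- by move=> d; exists (fun=> 0) => F n; rewrite weyl_act0 mul0r.
- move=> d S1 S2 [c1 h1] [c2 h2]; exists (fun n => c1 n + c2 n) => F n.
  by rewrite weyl_actD h1 h2 mulrDl.
- move=> d c S1 [c1 h1]; exists (fun n => c * c1 n) => F n.
  by rewrite weyl_actM weyl_actC h1 mulrA.
- by exists (fun=> 1) => F n; rewrite weyl_act1 mul1r subr0.
- move=> d [e|e] S1 [c1 h1].
    exists (fun n => (if eps e then 1 else (n@_e)%:~R) * c1 (n - << e >>)) => F n.
    by rewrite weyl_actM weyl_act_gen /= h1 mulrA opprD addrA.
  exists (fun n => (if eps e then (n@_e + 1)%:~R else 1) * c1 (n + << e >>)) => F n.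
  by rewrite weyl_actM weyl_act_gen /= h1 mulrA opprD addrA opprK.
Qed.

Definition half_supported e F : Prop := forall n, (0 <= n@_e) != eps e -> F n = 0.

(** Only a letter crossing the boundary could break this, and its coefficient vanishes there:
    [n@_e + 1] for y_e at weight -1, [n@_e] for x_e at weight 0. *)
Lemma letter_act_half_supported e a F :
  half_supported e F -> half_supported e (letter_act a F).
Proof.
move=> eF n; case: a => f /=.
- have Ef : (n - << f >>)@_e = n@_e - (f == e)%:R by rewrite mcoeffB mcoeffU.
  have [fe|fe] := eqVneq f e => ne; last first.
    by rewrite eF ?mulr0 // Ef (negbTE fe) subr0.
  rewrite fe eqxx in Ef; rewrite fe in ne Ef *.
  have [n0|n0] := eqVneq n@_e 0.
    move: ne; rewrite n0 lexx /=; case: (eps e) => // _.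
    by rewrite mulr0z mul0r.
  by rewrite eF ?mulr0 // Ef; move: ne; case: (eps e); lia.
- have Ef : (n + << f >>)@_e = n@_e + (f == e)%:R by rewrite mcoeffD mcoeffU.
  have [fe|fe] := eqVneq f e => ne; last first.
    by rewrite eF ?mulr0 // Ef (negbTE fe) addr0.
  rewrite fe eqxx in Ef; rewrite fe in ne Ef *.
  have [n0|n0] := eqVneq (n@_e + 1) 0.
    move: ne; rewrite n0 (_ : 0 <= n@_e = false); last by lia.
    by case: (eps e) => // _; rewrite mulr0z mul0r.
  by rewrite eF ?mulr0 // Ef; move: ne; case: (eps e); lia.
Qed.

Lemma weyl_act_half_supported e S F :
  half_supported e F -> half_supported e (weyl_act S F).
Proof.
move=> eF n ne; rewrite /weyl_act /free_act big1 // => w _.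
suff wF s : half_supported e (word_act s F) by rewrite wF ?mulr0.
by elim: s => [//|a s IHs] /=; exact: letter_act_half_supported.
Qed.

Hypothesis char0 : [pchar k] =i pred0.

(** For an allowed target weight [n], the integers multiplied are n_e + 1, n_e + 2, ... with n_e >=
    0, or n_e, n_e - 1, ... with n_e < 0. None is zero, even if [n - << p *g e >>] is forbidden. *)
Lemma weylz_act_neq0 e p n : (0 <= n@_e) = eps e ->
  exists2 c : k, c != 0 &
    forall F, weyl_act (weylz k e p) F n = c * F (n - << p *g e >>).
Proof.
have En m : << m%:Z *g e >> = << e >> *+ m :> ZE by rewrite -monalgUMn pmulrn intz.
have X m : eps e || (n@_e < 0) -> exists2 c : k, c != 0 &
    forall F, weyl_act (weylx k e ^+ m) F n = c * F (n - << m%:Z *g e >>).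
  elim: m n => [|m IHm] n ne.
    by exists 1; [exact: oner_neq0|move=> F; rewrite monalgU0 subr0 mul1r weyl_act1].
  have [|c c0 Hc] := IHm (n - << e >>).
    by rewrite mcoeffB mcoeffUU; move: ne; case: (eps e) => //=; lia.
  exists ((if eps e then 1 else (n@_e)%:~R) * c).
    rewrite mulf_neq0 //; move: ne; case: (eps e) => /= [_|ne]; first exact: oner_neq0.
    by rewrite char0_intr_eq0 // lt_eqF.
  move=> F; rewrite exprS weyl_actM weyl_act_gen /= Hc mulrA.
  by rewrite (En m) (En m.+1) mulrS opprD addrA.
have Y m : ~~ eps e || (0 <= n@_e) -> exists2 c : k, c != 0 &
    forall F, weyl_act (weyly k e ^+ m) F n = c * F (n + << m%:Z *g e >>).
  elim: m n {X} => [|m IHm] n ne.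
    by exists 1; [exact: oner_neq0|move=> F; rewrite monalgU0 addr0 mul1r weyl_act1].
  have [|c c0 Hc] := IHm (n + << e >>).
    by rewrite mcoeffD mcoeffUU; move: ne; case: (eps e) => //=; lia.
  exists ((if eps e then (n@_e + 1)%:~R else 1) * c).
    rewrite mulf_neq0 //; move: ne; case: (eps e) => /= [ne|_]; last exact: oner_neq0.
    by rewrite char0_intr_eq0 //; lia.
  move=> F; rewrite exprS weyl_actM weyl_act_gen /= Hc mulrA.
  by rewrite (En m) (En m.+1) mulrS addrA.
move=> ne; case: (intP p) => [|m|m].
- by apply: (X 0%N); rewrite -ne; case: leP.
- by apply: (X m.+1); rewrite -ne; case: leP.
- rewrite weylz_opp monalgUN opprK; apply: Y; rewrite -ne; by case: leP.
Qed.

Lemma weyl_mon_act_neq0 (h n : ZE) : (forall e, (0 <= n@_e) = eps e) ->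
  exists2 c : k, c != 0 & forall F, weyl_act (weyl_mon k h) F n = c * F (n - h).
Proof.
move=> ne; rewrite {2}[h]monalgE /weyl_mon.
have : forall e, e \in (msupp h : seq E) -> (0 <= n@_e) = eps e by move=> e _; exact: ne.
have := fset_uniq (msupp h); elim: (msupp h : seq E) n {ne} => [|e s IHs] n.
  move=> _ _; exists 1; first exact: oner_neq0.
  by move=> F; rewrite !big_nil subr0 mul1r weyl_act1.
rewrite /= => /andP[es us] ne.
have [c c0 Hc] := weylz_act_neq0 h@_e (ne e (mem_head _ _)).
have [//|f fs|d d0 Hd] := IHs (n - << h@_e *g e >>).
  rewrite mcoeffB mcoeffU (_ : (e == f) = false) ?subr0; last first.
    by apply: contraNF es => /eqP ->.
  by apply: ne; rewrite inE fs orbT.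
exists (c * d); first exact: mulf_neq0.
by move=> F; rewrite !big_cons weyl_actM Hc Hd mulrA opprD addrA.
Qed.

End WeylAction.

(** * The image of the canonical representation *)

Section CanonicalRep.
Variables (k : fieldType) (char0 : [pchar k] =i pred0).
Variables (V E : choiceType) (Γ : multiquiver V E).
Variable phi : {rmorphism quiver_tgw Γ char0 -> weyl k E}.
Hypothesis phi_canonical : is_canonical_rep phi.
Local Notation W := (weyl k E).
Local Notation RE := {malg k[{cmonom E}]}.
Local Notation T := (quiver_datum Γ char0).
Local Notation γ := (incid_map Γ).
Local Notation ZV := {malg int[V]}.
Local Notation M := (@weyl_mon k E).

Let Phi (p : tgw_free RE V) : W := phi (tgwA_pi T p).
Let psi (r : RE) : W := phi (tgwR T r).

Lemma canonical_free_ring_map : ring_map Phi.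
Proof.
have [p0 p1 pD pM] := quot_pi_ring_map (tgw_rel T).
have [q0 q1 qD qM] := quot_pi_ring_map (@tgw_rad _ _ _ T).
rewrite /Phi /tgwA_pi; split=> [||p q|p q].
- by rewrite -(rmorph0 phi); congr (phi _); rewrite -q0 -p0.
- by rewrite -(rmorph1 phi); congr (phi _); rewrite -q1 -p1.
- by rewrite -(rmorphD phi); congr (phi _); rewrite -[RHS]qD -[in RHS]pD.
- by rewrite -(rmorphM phi); congr (phi _); rewrite -[RHS]qM -[in RHS]pM.
Qed.

Lemma tgwA_pi_rel (p q : tgw_free RE V) :
  tgw_rel T (p - q) -> tgwA_pi T p = tgwA_pi T q.
Proof. by move=> /quot_pi_rel pq; congr (\pi_(quot (@tgw_rad _ _ _ T)) _). Qed.

Lemma canonical_psi_ring_map : ring_map psi.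
Proof.
have [_ P1 PD PM] := canonical_free_ring_map.
have psi_add : {morph psi : r s / r + s}.
  move=> r s; apply: etrans (PD _ _).
  exact/(congr1 phi)/tgwA_pi_rel/tgw_rel_add.
split; [| |exact: psi_add|].
- by apply: (addrI (psi 0)); rewrite -psi_add !addr0.
- by apply: etrans P1; exact/(congr1 phi)/tgwA_pi_rel/tgw_rel_one.
- move=> r s; apply: etrans (PM _ _).
  exact/(congr1 phi)/tgwA_pi_rel/tgw_rel_mul.
Qed.

Let psiC c : psi c%:A = weylC E c.
Proof. by have [+ _ _ _] := phi_canonical; apply. Qed.
Let psiU e : psi (polyu k e) = weyly k e * weylx k e.
Proof. by have [_ _ _ +] := phi_canonical; apply. Qed.

Lemma canonical_imageP g S : (phi @` quiver_comp g) S <->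
  exists2 p, free_comp (@tgw_deg _ RE V) g p & Phi p = S.
Proof.
split=> [[_ [_ [p gp <-] <-] <-]|[p gp <-]]; first by exists p.
exists (tgwA_pi T p) => //; exists (\pi_(quot (tgw_rel T)) p) => //.
by exists p.
Qed.

(** This inclusion holds for every multiquiver, since [phi] maps a generator of degree d to an
    element of degree γ(d). *)
Lemma canonical_image_sub g S :
  (phi @` quiver_comp g) S -> weyl_comp (γ g) S.
Proof.
move=> /canonical_imageP[p gp <-].
apply: (free_comp_sub (C := fun g => @weyl_comp k E (γ g)) canonical_free_ring_map) gp.
- by move=> d; exact: weyl_comp0.
- by move=> d; exact: weyl_compD.
- move=> d c S' hS; rewrite -[γ d]add0r; apply: weyl_compM hS.
  (* Coefficients in the free ring are integers, and their images are scalars of the Weyl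
     algebra. *)
  rewrite -[c]intz (rmorph_int (@malgC _ int)).
  rewrite (ring_map_int _ canonical_free_ring_map) -weylC_int; exact: weyl_compC.
- by rewrite incid_map0; exact: weyl_comp1.
- have [_ phiX phiY _] := phi_canonical.
  move=> d a S' hS; rewrite incid_mapD; apply: weyl_compM hS.
  case: a => [r|[v|v]] /=.
  + by rewrite incid_map0; exact: (weyl_comp_psi canonical_psi_ring_map).
  + by rewrite incid_mapU mulr1z -[Phi _]/(phi (tgwX T v)) phiX; exact: weyl_comp_mon.
  + rewrite -monalgUN incid_mapU mulrN1z -[Phi _]/(phi (tgwY T v)) phiY.
    exact: weyl_comp_mon.
Qed.

Local Notation im g := (phi @` quiver_comp g).

Lemma canonical_imageD g S S' : im g S -> im g S' -> im g (S + S').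
Proof.
have [_ _ PD _] := canonical_free_ring_map.
move=> /canonical_imageP[p gp <-] /canonical_imageP[q gq <-].
by apply/canonical_imageP; exists (p + q); [exact: free_compD | exact: PD].
Qed.

Lemma canonical_imageM g g' S S' : im g S -> im g' S' -> im (g + g') (S * S').
Proof.
have [_ _ _ PM] := canonical_free_ring_map.
move=> /canonical_imageP[p gp <-] /canonical_imageP[q gq <-].
by apply/canonical_imageP; exists (p * q); [exact: free_compM | exact: PM].
Qed.

Lemma canonical_image1 : im 0 1.
Proof.
have [_ P1 _ _] := canonical_free_ring_map.
apply/canonical_imageP; exists 1 => //.
exact: (@free_compC _ _ _ (@tgw_deg _ RE V) 1).
Qed.

Lemma canonical_imageX g S n : im g S -> im (g *+ n) (S ^+ n).
Proof.
move=> gS; elim: n => [|n IHn]; first exact: canonical_image1.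
by rewrite mulrS exprS; exact: canonical_imageM.
Qed.

Lemma canonical_image_letter a : im (@tgw_deg _ RE V a) (Phi (fgen int a)).
Proof. by apply/canonical_imageP; exists (fgen int a) => //; exact: free_comp_gen. Qed.

Lemma canonical_image_psi r : im 0 (psi r).
Proof. exact: (canonical_image_letter (inl r)). Qed.

Lemma canonical_image_vertex v c : im << c *g v >> (M (incid_vertex Γ v *~ c)).
Proof.
have [_ phiX phiY _] := phi_canonical.
have En n : << n%:Z *g v >> = << v >> *+ n :> ZV by rewrite -monalgUMn pmulrn intz.
case: (intP c) => [|n|n].
- by rewrite monalgU0 mulr0z weyl_mon0; exact: canonical_image1.
- rewrite En -pmulrn -weyl_monX -phiX.
  exact/canonical_imageX/(canonical_image_letter (inr (inl v))).
- rewrite monalgUN En -mulNrn mulrNz -pmulrn -mulNrn -weyl_monX -phiY.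
  exact/canonical_imageX/(canonical_image_letter (inr (inr v))).
Qed.

(** Induction on the size of the support, splitting off a leaf [v] with its full coefficient [m]. *)
Lemma acyclic_image_mon g : qacyclic Γ -> im g (M (γ g)).
Proof.
move=> acyc; have [n] := ubnP (size (msupp g)); elim: n g => // n IHn g ltn.
have [g0|gN0] := eqVneq (msupp g : seq V) [::].
  have -> : g = 0.
    apply/malgP => v; rewrite mcoeff0 mcoeff_outdom //.
    by rewrite -[_ \in _]/(v \in (msupp g : seq V)) g0.
  by rewrite incid_map0 weyl_mon0; exact: canonical_image1.
have [v vg leaf] := acyclic_leaf acyc gN0.
pose m := g@_v; pose g' := g - << m *g v >>.
have gE : g = << m *g v >> + g' by rewrite subrKC.
have g'E w : g'@_w = if w == v then 0 else g@_w.
  rewrite mcoeffB mcoeffU [v == w]eq_sym; case: eqP => [->|_]; first exact: subrr.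
  exact: subr0.
have sub w : w \in msupp g' -> w != v /\ w \in msupp g.
  by rewrite -!mcoeff_neq0 g'E; case: (w == v); rewrite ?eqxx.
have g'g : (size (msupp g') < n)%N.
  rewrite -ltnS; apply: leq_ltn_trans ltn; rewrite -[(size _).+1]/(size (v :: msupp g')).
  apply: uniq_leq_size => [|w]; rewrite /= ?fset_uniq ?andbT.
    by apply/negP => /sub[]; rewrite eqxx.
  by rewrite inE => /predU1P[->|/sub[]].
have im' := IHn _ g'g; have imv := canonical_image_vertex v m.
pose h := incid_vertex Γ v *~ m; pose h' := γ g'.
rewrite -/h in imv; rewrite -/h' in im'.
have -> : γ g = h + h' by rewrite {1}gE incid_mapD incid_mapU.
(* An edge at which the two exponents have opposite signs ends both at [v] and at another vertex of
   the support. *)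
have joins e : h@_e * h'@_e < 0 -> exists2 w, w \in msupp g & qjoins Γ e v w.
  move=> hh; have : h@_e * h'@_e != 0 by rewrite lt_eqF.
  rewrite mulf_eq0 negb_or => /andP[he h'e].
  have ev : incid Γ e v != 0.
    apply: contraNneq he => ev; rewrite /h raddfMz /= incid_vertexE ev.
    by rewrite mul0rz.
  have [w wg' ew] : exists2 w, w \in msupp g' & incid Γ e w != 0.
    apply: contrapT => now; case/eqP: h'e.
    rewrite (incid_map_coefw Γ _ (fset_uniq _) (fun _ => id)) big_seq big1 // => w wg'.
    have [->|ew] := eqVneq (incid Γ e w) 0; first by rewrite mul0r.
    by case: now; exists w.
  have [wv wg] := sub w wg'; exists w => //.
  by apply: incid_neq0_qjoins => //; rewrite eq_sym.
have [compat|/existsNP[e]] := pselect (forall e, 0 <= h@_e * h'@_e).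
  by rewrite -weyl_monM // gE; exact: canonical_imageM.
move/negP; rewrite -ltNge => he.
pose a := h@_e; pose b := h'@_e.
pose h1 := h - << a *g e >>; pose h1' := h' - << b *g e >>.
have h1e : h1@_e = 0 by rewrite mcoeffB mcoeffUU subrr.
have h1'e : h1'@_e = 0 by rewrite mcoeffB mcoeffUU subrr.
(* A second edge with cancellation would also join [v] to the support, against the choice of the
   leaf. *)
have compat f : 0 <= h1@_f * h1'@_f.
  have [->|fe] := eqVneq f e; first by rewrite h1e mul0r.
  rewrite !mcoeffB !mcoeffU eq_sym (negbTE fe) !subr0 leNgt.
  apply/negP => hf; have [w wg ew] := joins e he; have [w' wg' fw'] := joins f hf.
  by case/eqP: fe; exact: leaf fw' ew.
have [p [q pq]] := weylz_bezout canonical_psi_ring_map psiC psiU char0 e a b.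
suff -> : M (h + h') = psi p * (M h * M h') + psi q * (M h' * M h).
  apply: canonical_imageD; rewrite -[g]add0r;
    apply: canonical_imageM (canonical_image_psi _) _; rewrite gE.
    exact: canonical_imageM.
  by rewrite addrC; exact: canonical_imageM.
rewrite (weyl_mon_split k e (h + h')) (weyl_mon_split k e h) (weyl_mon_split k e h').
rewrite -/a -/b -/h1 -/h1'.
have -> : h + h' - << (h + h')@_e *g e >> = h1 + h1'.
  by rewrite mcoeffD monalgUD opprD addrACA.
rewrite mcoeffD -/a -/b -pq.
(* Brings the two factors at [e] together, so that the Bezout identity applies to them alone. *)
have mix c d (l l' : {malg int[E]}) : l@_e = 0 ->
    weylz k e c * M l * (weylz k e d * M l') =
    weylz k e c * weylz k e d * (M l * M l').
  move=> le; rewrite !mulrA; congr (_ * _); rewrite -!mulrA; congr (_ * _).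
  by apply/esym/comm_weylz_mon.
have MC : M h1' * M h1 = M (h1 + h1').
  by rewrite addrC weyl_monM // => f; rewrite mulrC.
rewrite (mix a b) // (mix b a) // MC weyl_monM // mulrDl.
by rewrite -[psi p * _ * _]mulrA -[psi q * _ * _]mulrA.
Qed.

(** The target component is k[u] times one monomial, and k[u] is already in the image of degree
    0. *)
Lemma acyclic_locally_surjective : qacyclic Γ -> locally_surjective phi.
Proof.
move=> acyc g; apply/seteqP; split=> S; first exact: canonical_image_sub.
move=> /(weyl_comp_normal canonical_psi_ring_map psiC psiU)[r ->].
have := canonical_imageM (canonical_image_psi r) (acyclic_image_mon g acyc).
by rewrite add0r.
Qed.

(* For [g] the sum of the vertices of a cycle, follow the partial degrees [d] of
   a word of degree [g].  When some cycle vertex [v j] first gets a positive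
   coefficient, the weight at the edge from [v (j - 1)] to [v j] has crossed to
   the forbidden half-line, so the word kills the indicator function [F], while
   [weyl_mon k (γ g)] does not. *)
Lemma locally_surjective_acyclic : locally_surjective phi -> qacyclic Γ.
Proof.
move=> surj [l [v [e [l2 v_inj e_inj joins]]]].
pose A i := incid Γ (e i) (v i); pose B i := incid Γ (e i) (v (ordS i)).
have AB i : (0 < A i /\ B i < 0) \/ (A i < 0 /\ 0 < B i).
  by have [a [b [a0 b0 [[Ai Bi]|[Ai Bi]]]]] := qjoins_incid (joins i);
    [left|right]; rewrite /A /B Ai Bi; split; lia.
(* The weight [w i] and the starting weight [w i - (A i + B i)] lie on the same side of the
   boundary, while adding only [B i] to the latter gives [w i - A i], just on the other side: -1 or
   0. *)
pose w i : int := if 0 < A i then A i - 1 else A i.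
pose N : {malg int[E]} := \sum_i << w i *g e i >>.
have NE i : N@_(e i) = w i.
  rewrite raddf_sum (bigD1 i) //= mcoeffUU big1 ?addr0 // => j ji.
  by rewrite mcoeffU (_ : (e j == e i) = false) //; apply: contra_neqF ji => /eqP /e_inj.
pose g : ZV := \sum_i << v i >>.
have gE i : g@_(v i) = 1.
  rewrite raddf_sum (bigD1 i) //= mcoeffUU big1 ?addr0 // => j ji.
  by rewrite mcoeffU (_ : (v j == v i) = false) //; apply: contra_neqF ji => /eqP /v_inj.
have γgE i : (γ g)@_(e i) = A i + B i.
  by rewrite (qjoins_incid_map _ (joins i)) !gE !mulr1.
(* This makes [N] allowed at every edge, as [weyl_mon_act_neq0] requires; [F] constrains only the
   edges of the cycle. *)
pose eps f := 0 <= N@_f.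
pose F (n : {malg int[E]}) : k := ([forall i, (0 <= n@_(e i)) == eps (e i)])%:R.
have F_supp i : half_supported eps (e i) F.
  move=> n ne; rewrite /F (_ : [forall _, _] = false) //.
  by apply/negbTE/forallPn; exists i.
(* An operator of degree [d] carries the weight [N - γ g] to [N - γ g + γ d]; for [d = g] this is
   [N]. *)
pose C (d : ZV) (S : W) := (exists j, 1 <= d@_(v j)) ->
  weyl_act eps S F (N - γ g + γ d) = 0.
have Cfree d p : free_comp (@tgw_deg _ RE V) d p -> C d (Phi p).
  apply: (free_comp_sub (C := C) canonical_free_ring_map).
  - by move=> d' _; rewrite weyl_act0.
  - by move=> d' S S' hS hS' dj; rewrite weyl_actD hS // hS' // addr0.
  - move=> d' c S hS dj; rewrite weyl_actM.
    rewrite -[c]intz (rmorph_int (@malgC _ int)).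
    by rewrite (ring_map_int _ canonical_free_ring_map) -weylC_int weyl_actC hS ?mulr0.
  - by move=> [j]; rewrite mcoeff0.
  - move=> d' a S hS [j dj].
    have [c Hc] := weyl_comp_shift eps (canonical_image_sub (canonical_image_letter a)).
    (* If [d'] is already positive somewhere on the cycle, the value is zero before the new letter,
       which only translates and rescales. *)
    have [d'j|nod'] := pselect (exists j, 1 <= d'@_(v j)).
      have nE : N - γ g + γ (tgw_deg a + d') - γ (tgw_deg a) = N - γ g + γ d'.
        by rewrite incid_mapD [γ _ + _]addrC addrA addrK.
      by rewrite weyl_actM Hc nE hS ?mulr0.
    have d'_le0 i : d'@_(v i) <= 0.
      by rewrite leNgt; apply/negP => d'i; apply: nod'; exists i; lia.
    (* Otherwise the new letter must be X at [v j], raising the coefficient there from 0 to 1. *)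
    have aE : tgw_deg a = << v j >>.
      have := d'_le0 j; move: dj; rewrite mcoeffD.
      case: a {Hc} => [r|[u|u]] /=; first by rewrite mcoeff0; lia.
        by rewrite mcoeffU; case: eqP => [->//|_] /=; lia.
      by rewrite mcoeffN mcoeffU; case: eqP => _ /=; lia.
    (* The edge into [v j] from its predecessor is the one whose weight becomes forbidden: the
       predecessor has coefficient at most 0, and [A i * d'@_(v i)] pushes no closer to the allowed
       side. *)
    have [i ij] : exists i, ordS i = j by exists (ord_pred j); exact: ord_predK.
    apply: (weyl_act_half_supported _ (F_supp i)).
    have vij : v i <> v j by have := qjoins_neq (joins i); rewrite ij.
    have -> : (N - γ g + γ (tgw_deg a + d'))@_(e i) =
        w i - (A i + B i) + (A i * d'@_(v i) + B i).
      rewrite !mcoeffD mcoeffN NE γgE (qjoins_incid_map _ (joins i)) ij aE.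
      rewrite !mcoeffD !mcoeffU eqxx (_ : (v j == v i) = false) ?add0r; last first.
        by apply/eqP => /esym.
      have -> : d'@_(v j) = 0.
        by apply: le_anti; rewrite d'_le0 /=; move: dj; rewrite aE mcoeffD mcoeffUU; lia.
      by rewrite addr0 mulr1 /B ij.
    rewrite /eps NE /w; have := d'_le0 i; case: (AB i) => -[Ai Bi].
      by rewrite Ai => di; nia.
    by rewrite ltNge (ltW Ai) /= => di; nia.
have := weyl_comp_mon k (γ g); rewrite -surj => /canonical_imageP[p gp pM].
have := Cfree _ _ gp; rewrite pM /C => /(_ _)/wrap[].
  by exists (Ordinal (ltnW l2)); rewrite gE.
(* At [N] the monomial gives a nonzero multiple of [F (N - γ g)], and [N - γ g] is allowed at every
   cycle edge. *)
have [c c0 Hc] := weyl_mon_act_neq0 char0 (γ g) (fun f => erefl (eps f)).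
rewrite subrK Hc => /eqP; rewrite mulf_eq0 (negbTE c0) /=.
rewrite /F (_ : [forall _, _] = true) ?oner_eq0 //.
apply/forallP => i; rewrite /eps mcoeffB NE γgE /w.
by case: (AB i) => -[Ai Bi]; rewrite ?Ai ?ltNge ?(ltW Ai) /=; apply/eqP; lia.
Qed.

End CanonicalRep.

Theorem theorem4p18 (k : fieldType) (char0 : [pchar k]%R =i pred0)
    (V E : choiceType) (Γ : multiquiver V E)
    (phi : {rmorphism quiver_tgw Γ char0 -> weyl k E})
    (phi_canonical : is_canonical_rep phi) :
  locally_surjective phi <-> qacyclic Γ.
Proof.
split; first exact: locally_surjective_acyclic.
exact: acyclic_locally_surjective.
Qed.
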